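(* Let $\gamma>0$ and let $g\in\mathcal{B}_0$ be a non-constant function satisfying $g',\frac1{g'}\in H^\infty$. Then $A^{-\gamma}$ is a proper subspace of $[V_g,A^{-\gamma}_0]=[T_g,A^{-\gamma}_0]=A^{-(\gamma+1)}_0$.
   Context: $\mathbb{D}=\{z\in\mathbb{C}:|z|<1\}$; $H(\mathbb{D})$ is the Fréchet space of all analytic functions on $\mathbb{D}$ with the topology of uniform convergence on compact sets; $H^\infty$ is the space of bounded analytic functions on $\mathbb{D}$. The condition $\frac1{g'}\in H^\infty$ means that $g'$ has no zeros in $\mathbb{D}$ and $1/g'$ is bounded. For $g,f\in H(\mathbb{D})$, $(V_gf)(z):=\int_0^z f(\xi)g'(\xi)\,d\xi$ for $z\in\mathbb{D}$, and $(T_gf)(z):=\frac1z\int_0^z f(\xi)g'(\xi)\,d\xi$ for $z\in\mathbb{D}\setminus\{0\}$, $(T_gf)(0):=f(0)g'(0)$. For $\gamma>0$ the Korenblum growth spaces are $A^{-\gamma}:=\{f\in H(\mathbb{D}):\sup_{z\in\mathbb{D}}(1-|z|)^\gamma|f(z)|<\infty\}$ and $A^{-\gamma}_0:=\{f\in H(\mathbb{D}):\lim_{|z|\to1^-}(1-|z|)^\gamma|f(z)|=0\}$, both Banach spaces for the norm $\sup_{z\in\mathbb{D}}(1-|z|)^\gamma|f(z)|$. The Bloch space is $\mathcal{B}:=\{h\in H(\mathbb{D}):\sup_{z\in\mathbb{D}}(1-|z|)|h'(z)|<\infty\}$, and the little Bloch space $\mathcal{B}_0$ consists of all $h\in\mathcal{B}$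 with $\lim_{|z|\to1^-}(1-|z|)|h'(z)|=0$. For $X$ a Banach space continuously included in $H(\mathbb{D})$ and $T\colon H(\mathbb{D})\to H(\mathbb{D})$ continuous linear with $T(X)\subseteq X$, the optimal domain is $[T,X]:=\{f\in H(\mathbb{D}):Tf\in X\}$ with (semi-)norm $\|f\|_{[T,X]}:=\|Tf\|_X$. *)

(* Defs.v *)
From Stdlib Require Import Reals Lra.
From Coquelicot Require Import Coquelicot.
Open Scope R_scope.

(* Functions on the disc are represented by total functions [C -> C].  Every
   predicate on them below depends only on the values taken on the open unit
   disc, so the values elsewhere are irrelevant. *)
Definition unit_disc (z : C) : Prop := Cmod z < 1.

Definition holo (f : C -> C) : Prop :=
  forall z : C, unit_disc z ->
    ex_derive (K := C_AbsRing) (V := C_NormedModule) f z.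

Definition Hinf (f : C -> C) : Prop :=
  holo f /\ exists M : R, forall z : C, unit_disc z -> Cmod (f z) <= M.

(* The filter of the limit |z| -> 1-, uniform in the argument of z. *)
Definition to_circle (P : C -> Prop) : Prop :=
  at_left 1 (fun r : R => forall z : C, Cmod z = r -> P z).

Global Instance to_circle_proper : ProperFilter to_circle.
Proof.
split.
- intros P [d Hd].
  assert (Hp : 0 < d) by apply cond_pos.
  pose proof (Rmax_l 0 (1 - d / 2)); pose proof (Rmax_r 0 (1 - d / 2)).
  assert (Rmax 0 (1 - d / 2) < 1) by (apply Rmax_lub_lt; lra).
  set (r := Rmax 0 (1 - d / 2)) in *.
  exists (RtoC r); apply (Hd r).
  + apply Rabs_def1; unfold minus, plus, opp; simpl; lra.
  + assumption.
  + rewrite Cmod_R; apply Rabs_pos_eq; assumption.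
- split; unfold to_circle.
  + now apply filter_forall.
  + intros P Q HP HQ.
    generalize (filter_and (F := at_left 1) _ _ HP HQ).
    apply filter_imp; intros r [H1 H2] z Hz; split; auto.
  + intros P Q H; apply filter_imp; auto.
Qed.

Definition korenblum_weight (gamma : R) (f : C -> C) (z : C) : R :=
  Rpower (1 - Cmod z) gamma * Cmod (f z).

Definition korenblum (gamma : R) (f : C -> C) : Prop :=
  holo f /\
  exists M : R, forall z : C, unit_disc z -> korenblum_weight gamma f z <= M.

Definition korenblum0 (gamma : R) (f : C -> C) : Prop :=
  holo f /\ filterlim (korenblum_weight gamma f) to_circle (locally 0).

Definition bloch (h : C -> C) : Prop :=
  holo h /\
  exists M : R, forall z : C, unit_disc z ->
    (1 - Cmod z) * Cmod (C_derive h z) <= M.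

Definition little_bloch (h : C -> C) : Prop :=
  bloch h /\
  filterlim (fun z : C => (1 - Cmod z) * Cmod (C_derive h z))
    to_circle (locally 0).

(* The path integral from 0 to z is taken along the segment t |-> t z. *)
Definition volterra (g f : C -> C) (z : C) : C :=
  RInt (V := C_R_CompleteNormedModule)
    (fun t : R => (f (t * z) * C_derive g (t * z) * z)%C) 0 1.

Definition volterra_avg (g f : C -> C) (z : C) : C :=
  if Ceq_dec z 0 then (f 0 * C_derive g 0)%C else (/ z * volterra g f z)%C.

Definition optimal_domain (T : (C -> C) -> (C -> C)) (X : (C -> C) -> Prop)
    (f : C -> C) : Prop :=
  holo f /\ X (T f).

Definition linear_subspace (U : (C -> C) -> Prop) : Prop :=
  U (fun _ => RtoC 0) /\
  (forall f h, U f -> U h -> U (fun z => (f z + h z)%C)) /\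
  (forall (c : C) f, U f -> U (fun z => (c * f z)%C)).

Definition proper_subspace (U W : (C -> C) -> Prop) : Prop :=
  linear_subspace U /\ linear_subspace W /\
  (forall f, U f -> W f) /\ (exists f, W f /\ ~ U f).

(* Main.v *)
(** For [f] holomorphic put [h := f g'] and [F z := V_g f z], the integral of [h]
    from [0] to [z].  Goursat's lemma gives [F' = h].  If [h] is
    [o((1 - |z|)^-(gamma + 1))], integrating along radii gives
    [F = o((1 - |z|)^-gamma)]; the converse is Cauchy's estimate for [F'] on the
    disc of centre [z] and radius [(1 - |z|) / 2].  As [g'] and [1 / g'] are
    bounded, [h] and [f] have the same growth, and dividing [F] by [z] does not
    affect the growth near the circle.  The inclusion of [A^-gamma] is strict
    because of [(1 - z)^(- k / 2)] for an integer [k] with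
    [gamma < k / 2 < gamma + 1]; half-integers only require a square root. *)
Require Import Defs.
From Stdlib Require Import Reals Lra Lia IndefiniteDescription.
From Coquelicot Require Import Coquelicot.

(** * Complex differentiability *)

(** Goursat's lemma on closed convex sets is the only contour argument. Its local step compares an
    integral along a segment with the exactly known integral of an affine function. The same
    comparison gives the second-order expansion of F at 0, so F / z is differentiable there once it
    gets the value h(0). Cauchy's estimate appears with the constant 2 M / r: the difference F -
    F(z) is integrated in order to have a limit at the centre, and a constant factor is harmless in
    a little-o statement. The radius (1 - |z|) / 2 keeps 1 - |w| at least half of 1 - |z| on the
    whole disc, so the weights at w and z are comparable. In the other direction gamma > 0 enters
    twice: the integral of (1 - t)^-(gamma + 1) grows like (1 - |z|)^-gamma / gamma, and the bounded
    contribution of the inner disc, where h is not yet small against the weight, is killed by the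
    factor (1 - |z|)^gamma. *)

Notation cderive f z l :=
  (is_derive (K := C_AbsRing) (V := C_NormedModule) f z l).

Definition ccont (f : C -> C) (z : C) : Prop :=
  forall eps, 0 < eps -> exists d, 0 < d /\
    forall w, Cmod (w - z) < d -> Cmod (f w - f z) < eps.

Lemma Cmod_sub_sym (a b : C) : Cmod (a - b) = Cmod (b - a).
Proof. rewrite <- Cmod_opp; f_equal; ring. Qed.

Lemma Cmod_sub_triangle (a b c : C) : Cmod (a - c) <= Cmod (a - b) + Cmod (b - c).
Proof.
replace (a - c)%C with ((a - b) + (b - c))%C by ring; apply Cmod_triangle.
Qed.

Lemma Cmod_le_sub (a b : C) : Cmod a <= Cmod b + Cmod (a - b).
Proof.
replace a with (b + (a - b))%C at 1 by ring; apply Cmod_triangle.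
Qed.

Lemma Cmod_sub_le (a b : C) : Cmod (a - b) <= Cmod a + Cmod b.
Proof. rewrite <- (Cmod_opp b); apply Cmod_triangle. Qed.

Lemma Csub_diag (z : C) : Cmod (z - z) = 0.
Proof. replace (z - z)%C with (RtoC 0) by ring; apply Cmod_0. Qed.

Lemma Csub_neq0 (a b : C) : a <> b -> 0 < Cmod (a - b).
Proof. intros H; apply Cmod_gt_0; intros E; apply H, Ceq_minus, E. Qed.

Lemma le_epsilon_mult (x k : R) : 0 <= k ->
  (forall eps, 0 < eps -> x <= k * eps) -> x <= 0.
Proof.
intros Hk H; apply le_epsilon; intros e He; rewrite Rplus_0_l.
(* Dividing by [k + 1] covers the case [k = 0]; the same device recurs below with [Rabs M + 1] and
   the like. *)
apply Rle_trans with (k * (e / (k + 1))).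
- apply H, Rdiv_lt_0_compat; lra.
- apply Rle_trans with ((k + 1) * (e / (k + 1))); [|right; field; lra].
  apply Rmult_le_compat_r; [|lra].
  left; apply Rdiv_lt_0_compat; lra.
Qed.

Lemma cderive_iff (f : C -> C) (z l : C) :
  cderive f z l <->
  forall eps, 0 < eps -> exists d, 0 < d /\ forall w, Cmod (w - z) < d ->
    Cmod (f w - f z - l * (w - z)) <= eps * Cmod (w - z).
Proof.
split.
- intros [_ H] eps Heps.
  specialize (H z (fun P HP => HP) (mkposreal eps Heps)).
  destruct H as [d Hd]; exists d; split; [apply cond_pos|].
  intros w Hw; specialize (Hd w Hw).
  (* The differential in [is_derive] is [scal (w - z) l], with the increment on the left; after this
     swap the two forms are convertible. *)
  replace (f w - f z - l * (w - z))%C with (f w - f z - (w - z) * l)%C by ring.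
  exact Hd.
- intros H; split; [apply is_linear_scal_l|].
  intros x Hx.
  apply (is_filter_lim_locally_unique (V := AbsRing_NormedModule C_AbsRing) z x)
    in Hx; subst x.
  intros eps; destruct (H eps (cond_pos eps)) as [d [Hd Hf]].
  exists (mkposreal d Hd); intros w Hw; specialize (Hf w Hw).
  replace (f w - f z - l * (w - z))%C with (f w - f z - (w - z) * l)%C in Hf by ring.
  exact Hf.
Qed.

Lemma ccont_const (c z : C) : ccont (fun _ => c) z.
Proof.
intros e He; exists 1; split; [lra|]; intros w _; rewrite Csub_diag; exact He.
Qed.

Lemma ccont_id (z : C) : ccont (fun w => w) z.
Proof. intros e He; exists e; auto. Qed.

Lemma ccont_local (f g : C -> C) (z : C) (r : R) : 0 < r ->
  (forall w, Cmod (w - z) < r -> f w = g w) -> ccont f z -> ccont g z.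
Proof.
intros Hr H Hf e He; destruct (Hf e He) as [d [Hd Hd']].
exists (Rmin d r); split; [now apply Rmin_glb_lt|].
intros w Hw; rewrite <- !H.
- apply Hd', Rlt_le_trans with (1 := Hw), Rmin_l.
- rewrite Csub_diag; lra.
- apply Rlt_le_trans with (1 := Hw), Rmin_r.
Qed.

Lemma ccont_ext (f g : C -> C) (z : C) :
  (forall w, f w = g w) -> ccont f z -> ccont g z.
Proof. intros H; apply (ccont_local f g z 1); [lra|auto]. Qed.

Lemma ccont_plus (f g : C -> C) (z : C) : ccont f z -> ccont g z ->
  ccont (fun w => f w + g w)%C z.
Proof.
intros Hf Hg e He.
destruct (Hf (e / 2)) as [d [Hd Hfd]]; [lra|].
destruct (Hg (e / 2)) as [d' [Hd' Hgd]]; [lra|].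
exists (Rmin d d'); split; [now apply Rmin_glb_lt|].
intros w Hw.
assert (H1 := Hfd w (Rlt_le_trans _ _ _ Hw (Rmin_l _ _))).
assert (H2 := Hgd w (Rlt_le_trans _ _ _ Hw (Rmin_r _ _))).
replace (f w + g w - (f z + g z))%C with ((f w - f z) + (g w - g z))%C by ring.
generalize (Cmod_triangle (f w - f z) (g w - g z)); lra.
Qed.

Lemma ccont_bounded (f : C -> C) (z : C) : ccont f z ->
  exists d, 0 < d /\ forall w, Cmod (w - z) < d -> Cmod (f w) < Cmod (f z) + 1.
Proof.
intros Hf; destruct (Hf 1) as [d [Hd H]]; [lra|].
exists d; split; [exact Hd|]; intros w Hw; specialize (H w Hw).
generalize (Cmod_le_sub (f w) (f z)); lra.
Qed.

Lemma ccont_mult (f g : C -> C) (z : C) : ccont f z -> ccont g z ->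
  ccont (fun w => f w * g w)%C z.
Proof.
intros Hf Hg e He.
assert (P1 := Cmod_ge_0 (f z)); assert (P2 := Cmod_ge_0 (g z)).
set (k := Cmod (f z) + Cmod (g z) + 1).
assert (Hk : 0 < k) by (unfold k; lra).
destruct (ccont_bounded g z Hg) as [d0 [Hd0 Hg0]].
destruct (Hf (e / (2 * k))) as [d [Hd Hfd]]; [apply Rdiv_lt_0_compat; lra|].
destruct (Hg (e / (2 * k))) as [d' [Hd' Hgd]]; [apply Rdiv_lt_0_compat; lra|].
exists (Rmin d0 (Rmin d d')); split; [repeat apply Rmin_glb_lt; assumption|].
intros w Hw.
assert (H0 := Hg0 w (Rlt_le_trans _ _ _ Hw (Rmin_l _ _))).
assert (Hw' := Rlt_le_trans _ _ _ Hw (Rmin_r _ _)).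
assert (H1 := Hfd w (Rlt_le_trans _ _ _ Hw' (Rmin_l _ _))).
assert (H2 := Hgd w (Rlt_le_trans _ _ _ Hw' (Rmin_r _ _))).
replace (f w * g w - f z * g z)%C
  with ((f w - f z) * g w + f z * (g w - g z))%C by ring.
apply Rle_lt_trans with (1 := Cmod_triangle _ _).
rewrite !Cmod_mult.
assert (E : e = e / (2 * k) * k + k * (e / (2 * k))) by (field; lra).
assert (Q := Cmod_ge_0 (f w - f z)); assert (Q' := Cmod_ge_0 (g w - g z)).
assert (Q2 := Cmod_ge_0 (g w)).
rewrite E; apply Rplus_lt_le_compat.
- apply Rle_lt_trans with (Cmod (f w - f z) * k).
  + apply Rmult_le_compat_l; [assumption|unfold k; lra].
  + now apply Rmult_lt_compat_r.
- apply Rmult_le_compat; [exact P1|exact Q'|unfold k; lra|lra].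
Qed.

Lemma ccont_opp (f : C -> C) (z : C) : ccont f z -> ccont (fun w => - f w)%C z.
Proof.
intros H; apply (ccont_ext (fun w => RtoC (-1) * f w)%C).
- intros w; ring.
- apply ccont_mult; [apply ccont_const|exact H].
Qed.

Lemma ccont_inv (f : C -> C) (z : C) : ccont f z -> f z <> RtoC 0 ->
  ccont (fun w => / f w)%C z.
Proof.
intros Hf Hz e He.
assert (P : 0 < Cmod (f z)) by now apply Cmod_gt_0.
set (m := Cmod (f z)) in *.
(* The first radius keeps |f w| > m / 2, hence |f w * f z| > m * m / 2, which is the factor in the
   second tolerance. *)
destruct (Hf (m / 2)) as [d [Hd Hfd]]; [lra|].
destruct (Hf (e * m * m / 2)) as [d' [Hd' Hfd']].
{ apply Rdiv_lt_0_compat; [|lra]; repeat apply Rmult_lt_0_compat; assumption. }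
exists (Rmin d d'); split; [now apply Rmin_glb_lt|].
intros w Hw.
assert (H1 := Hfd w (Rlt_le_trans _ _ _ Hw (Rmin_l _ _))).
assert (H2 := Hfd' w (Rlt_le_trans _ _ _ Hw (Rmin_r _ _))).
assert (H3 : m / 2 < Cmod (f w)).
{ generalize (Cmod_le_sub (f z) (f w)); rewrite (Cmod_sub_sym (f z)).
  fold m; lra. }
assert (Hw0 : f w <> RtoC 0) by (apply Cmod_gt_0; lra).
replace (/ f w - / f z)%C with (- (f w - f z) / (f w * f z))%C by (field; auto).
rewrite Cmod_div by (now apply Cmult_neq_0).
rewrite Cmod_opp, Cmod_mult; fold m.
apply Rmult_lt_reg_r with (Cmod (f w) * m).
{ apply Rmult_lt_0_compat; lra. }
replace (Cmod (f w - f z) / (Cmod (f w) * m) * (Cmod (f w) * m))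
  with (Cmod (f w - f z)) by (field; lra).
apply Rlt_le_trans with (1 := H2).
replace (e * m * m / 2) with (e * ((m / 2) * m)) by field.
apply Rmult_le_compat_l; [lra|]; apply Rmult_le_compat_r; lra.
Qed.

Lemma ccont_comp (f g : C -> C) (z : C) : ccont g z -> ccont f (g z) ->
  ccont (fun w => f (g w)) z.
Proof.
intros Hg Hf e He; destruct (Hf e He) as [d [Hd Hfd]].
destruct (Hg d Hd) as [d' [Hd' Hgd]].
exists d'; split; auto.
Qed.

(* Caratheodory's form of differentiability: it reduces the rules of
   differentiation to those of continuity. *)
Lemma cderive_slope (f phi : C -> C) (z : C) (r : R) : 0 < r -> ccont phi z ->
  (forall w, Cmod (w - z) < r -> f w = f z + phi w * (w - z))%C ->
  cderive f z (phi z).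
Proof.
intros Hr Hphi H; apply cderive_iff; intros e He.
destruct (Hphi e He) as [d [Hd Hd']].
exists (Rmin d r); split; [now apply Rmin_glb_lt|].
intros w Hw; rewrite (H w) by (apply Rlt_le_trans with (1 := Hw), Rmin_r).
replace (f z + phi w * (w - z) - f z - phi z * (w - z))%C
  with ((phi w - phi z) * (w - z))%C by ring.
rewrite Cmod_mult; apply Rmult_le_compat_r; [apply Cmod_ge_0|].
left; apply Hd', Rlt_le_trans with (1 := Hw), Rmin_l.
Qed.

(** Converse of [cderive_slope]: the difference quotient, completed by [l] at [z], is continuous at
    [z]. Its identity holds for every [w], so products and composites need no case distinction. *)
Lemma cderive_slope_ex (f : C -> C) (z l : C) : cderive f z l ->
  exists phi, ccont phi z /\ phi z = l /\
    forall w, (f w = f z + phi w * (w - z))%C.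
Proof.
intros H.
exists (fun w => if Ceq_dec w z then l else ((f w - f z) / (w - z))%C).
assert (E : (if Ceq_dec z z then l else ((f z - f z) / (z - z))%C) = l)
  by (destruct (Ceq_dec z z); [reflexivity|now elim n]).
split; [|split; [exact E|]].
- intros e He.
  destruct (proj1 (cderive_iff f z l) H (e / 2)) as [d [Hd Hf]]; [lra|].
  exists d; split; [exact Hd|]; intros w Hw; rewrite E.
  destruct (Ceq_dec w z) as [->|Hn]; [rewrite Csub_diag; lra|].
  assert (P := Csub_neq0 _ _ Hn).
  assert (N := Cminus_eq_contra _ _ Hn).
  replace ((f w - f z) / (w - z) - l)%C
    with ((f w - f z - l * (w - z)) / (w - z))%C by (field; auto).
  rewrite Cmod_div by assumption.
  apply Rle_lt_trans with (e / 2); [|lra].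
  apply Rmult_le_reg_r with (Cmod (w - z)); [exact P|].
  unfold Rdiv at 1; rewrite Rmult_assoc, Rinv_l, Rmult_1_r by lra.
  now apply Hf.
- intros w; destruct (Ceq_dec w z) as [->|Hn]; [ring|].
  field; now apply Cminus_eq_contra.
Qed.

Lemma cderive_ccont (f : C -> C) (z l : C) : cderive f z l -> ccont f z.
Proof.
intros H; destruct (cderive_slope_ex f z l H) as [phi [Hc [_ E]]].
apply (ccont_ext (fun w => f z + phi w * (w + - z))%C).
- intros w; rewrite (E w); reflexivity.
- apply ccont_plus; [apply ccont_const|]; apply ccont_mult; [exact Hc|].
  apply ccont_plus; [apply ccont_id|apply ccont_const].
Qed.

Lemma cderive_eq (f : C -> C) (z l l' : C) : cderive f z l -> l = l' ->
  cderive f z l'.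
Proof. now intros H <-. Qed.

Lemma cderive_local (f g : C -> C) (z l : C) (r : R) : 0 < r ->
  (forall w, Cmod (w - z) < r -> f w = g w) -> cderive f z l -> cderive g z l.
Proof.
intros Hr H Hf; destruct (cderive_slope_ex f z l Hf) as [phi [Hc [<- E]]].
apply (cderive_slope g phi z r); auto.
intros w Hw; rewrite <- (H w Hw), <- (H z); [apply E|].
rewrite Csub_diag; exact Hr.
Qed.

Lemma cderive_const (c z : C) : cderive (fun _ => c) z (RtoC 0).
Proof.
apply (cderive_slope (fun _ => c) (fun _ => RtoC 0) z 1 Rlt_0_1).
- apply ccont_const.
- intros; ring.
Qed.

Lemma cderive_id (z : C) : cderive (fun w => w) z (RtoC 1).
Proof.
apply (cderive_slope (fun w => w) (fun _ => RtoC 1) z 1 Rlt_0_1).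
- apply ccont_const.
- intros; ring.
Qed.

Lemma cderive_plus (f g : C -> C) (z l m : C) : cderive f z l -> cderive g z m ->
  cderive (fun w => f w + g w)%C z (l + m)%C.
Proof.
intros Hf Hg; destruct (cderive_slope_ex f z l Hf) as [p [Hp [<- E]]].
destruct (cderive_slope_ex g z m Hg) as [q [Hq [<- E']]].
apply (cderive_slope _ (fun w => p w + q w)%C z 1 Rlt_0_1).
- now apply ccont_plus.
- intros w _; rewrite (E w), (E' w); ring.
Qed.

Lemma cderive_mult (f g : C -> C) (z l m : C) : cderive f z l -> cderive g z m ->
  cderive (fun w => f w * g w)%C z (l * g z + f z * m)%C.
Proof.
intros Hf Hg; destruct (cderive_slope_ex f z l Hf) as [p [Hp [<- E]]].
assert (Hgc := cderive_ccont g z m Hg).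
destruct (cderive_slope_ex g z m Hg) as [q [Hq [<- E']]].
apply (cderive_slope _ (fun w => p w * g w + f z * q w)%C z 1 Rlt_0_1).
- apply ccont_plus; apply ccont_mult; auto; apply ccont_const.
- intros w _; rewrite (E w), (E' w); ring.
Qed.

Lemma cderive_inv (f : C -> C) (z l : C) : cderive f z l -> f z <> RtoC 0 ->
  cderive (fun w => / f w)%C z (- l / (f z * f z))%C.
Proof.
intros Hf Hz; assert (Hc := cderive_ccont f z l Hf).
destruct (cderive_slope_ex f z l Hf) as [p [Hp [<- E]]].
destruct (Hc (Cmod (f z))) as [d [Hd Hd']]; [now apply Cmod_gt_0|].
apply (cderive_slope _ (fun w => - p w * / (f w * f z))%C z d Hd).
- apply ccont_mult; [now apply ccont_opp|].
  apply ccont_inv; [|now apply Cmult_neq_0].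
  apply ccont_mult; [exact Hc|apply ccont_const].
- intros w Hw; specialize (Hd' w Hw).
  assert (Hw0 : f w <> RtoC 0).
  { intros Z; rewrite Z in Hd'; revert Hd'.
    replace (0 - f z)%C with (- f z)%C by ring; rewrite Cmod_opp; lra. }
  replace (- p w * / (f w * f z) * (w - z))%C
    with (- (p w * (w - z)) / (f w * f z))%C by (field; auto).
  replace (p w * (w - z))%C with (f w - f z)%C by (rewrite (E w); ring).
  field; auto.
Qed.

Lemma cderive_comp (f g : C -> C) (z l m : C) : cderive g z m ->
  cderive f (g z) l -> cderive (fun w => f (g w)) z (l * m)%C.
Proof.
intros Hg Hf; assert (Hc := cderive_ccont g z m Hg).
destruct (cderive_slope_ex f (g z) l Hf) as [p [Hp [<- E]]].
destruct (cderive_slope_ex g z m Hg) as [q [Hq [<- E']]].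
apply (cderive_slope _ (fun w => p (g w) * q w)%C z 1 Rlt_0_1).
- apply ccont_mult; [|exact Hq]; now apply ccont_comp.
- intros w _; rewrite (E (g w)).
  replace (g w - g z)%C with (q w * (w - z))%C by (rewrite (E' w); ring).
  ring.
Qed.

(** * Integrals along segments *)

Notation is_cint p a b l := (is_RInt (V := C_R_NormedModule) p a b l).

(** The crude factor 2 in place of sqrt 2 keeps the later constants rational. *)
Lemma Cmod_le_2Rmax (z : C) (e : R) :
  Rabs (fst z) <= e -> Rabs (snd z) <= e -> Cmod z <= 2 * e.
Proof.
intros H1 H2; apply Rle_trans with (1 := Cmod_2Rmax z).
assert (M := Rmax_lub _ _ _ H1 H2).
assert (P : 0 <= Rmax (Rabs (fst z)) (Rabs (snd z)))
  by (apply Rle_trans with (1 := Rabs_pos (fst z)), Rmax_l).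
assert (S := sqrt_pos 2).
assert (sqrt 2 <= 2).
{ rewrite <- (sqrt_Rsqr 2) at 2 by lra; apply sqrt_le_1; unfold Rsqr; lra. }
apply Rmult_le_compat; assumption.
Qed.

Lemma is_cint_ext (p q : R -> C) (a b : R) (l : C) : (forall t : R, p t = q t) ->
  is_cint p a b l -> is_cint q a b l.
Proof. intros H; apply is_RInt_ext; intros t _; apply H. Qed.

Lemma continuous_path (p : R -> C) (t : R) :
  (forall eps, 0 < eps -> exists d, 0 < d /\
     forall s, Rabs (s - t) < d -> Cmod (p s - p t) < eps) ->
  continuous (U := C_R_NormedModule) p t.
Proof.
intros H; apply filterlim_locally; intros eps.
destruct (H eps (cond_pos eps)) as [d [Hd Hp]].
exists (mkposreal d Hd); intros s Hs.
apply C_NormedModule_mixin_compat1, Hp, Hs.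
Qed.

Definition seg (a b : C) (t : R) : C := (a + t * (b - a))%C.

Definition seg_int (f : C -> C) (a b : C) : C :=
  RInt (V := C_R_CompleteNormedModule) (fun t => (f (seg a b t) * (b - a))%C) 0 1.

(** Continuity is meant in a full planar neighbourhood of each point, endpoints included; the
    integrand is then continuous from both sides at 0 and at 1. *)
Definition seg_cont (f : C -> C) (a b : C) : Prop :=
  forall t, 0 <= t <= 1 -> ccont f (seg a b t).

Lemma seg_dist (a b : C) (s t : R) :
  Cmod (seg a b s - seg a b t) = Rabs (s - t) * Cmod (b - a).
Proof.
unfold seg; replace (a + s * (b - a) - (a + t * (b - a)))%C
  with (RtoC (s - t) * (b - a))%C by (rewrite RtoC_minus; ring).
now rewrite Cmod_mult, Cmod_R.
Qed.

Lemma seg_int_correct (f : C -> C) (a b : C) : seg_cont f a b ->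
  is_cint (fun t => (f (seg a b t) * (b - a))%C) 0 1 (seg_int f a b).
Proof.
intros H; apply (RInt_correct (V := C_R_CompleteNormedModule)).
apply (ex_RInt_continuous (V := C_R_CompleteNormedModule)).
rewrite Rmin_left, Rmax_right by lra.
intros t Ht; apply continuous_path; intros e He.
assert (P := Cmod_ge_0 (b - a)).
destruct (H t Ht (e / (Cmod (b - a) + 1))) as [d [Hd Hf]].
{ apply Rdiv_lt_0_compat; lra. }
exists (d / (Cmod (b - a) + 1)); split; [apply Rdiv_lt_0_compat; lra|].
intros s Hs.
replace (f (seg a b s) * (b - a) - f (seg a b t) * (b - a))%C
  with ((f (seg a b s) - f (seg a b t)) * (b - a))%C by ring.
rewrite Cmod_mult.
assert (Q := Rabs_pos (s - t)).
assert (B : Cmod (f (seg a b s) - f (seg a b t)) < e / (Cmod (b - a) + 1)).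
{ apply Hf; rewrite seg_dist.
  apply Rle_lt_trans with (Rabs (s - t) * (Cmod (b - a) + 1)).
  - apply Rmult_le_compat_l; lra.
  - apply (Rmult_lt_compat_r (Cmod (b - a) + 1)) in Hs; [|lra].
    replace (d / (Cmod (b - a) + 1) * (Cmod (b - a) + 1)) with d in Hs
      by (field; lra).
    exact Hs. }
apply Rle_lt_trans
  with (Cmod (f (seg a b s) - f (seg a b t)) * (Cmod (b - a) + 1)).
- apply Rmult_le_compat_l; [apply Cmod_ge_0|lra].
- apply (Rmult_lt_compat_r (Cmod (b - a) + 1)) in B; [|lra].
  replace (e / (Cmod (b - a) + 1) * (Cmod (b - a) + 1)) with e in B
    by (field; lra).
  exact B.
Qed.

Lemma seg_int_unique (f : C -> C) (a b l : C) :
  is_cint (fun t => (f (seg a b t) * (b - a))%C) 0 1 l -> seg_int f a b = l.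
Proof. apply (is_RInt_unique (V := C_R_CompleteNormedModule)). Qed.

Lemma is_cint_affine (A B : C) :
  is_cint (fun t => (A + t * B)%C) 0 1 (A + B / 2)%C.
Proof.
assert (L : forall u v, is_RInt (fun t => u + t * v) 0 1 (u + v / 2)).
{ intros u v.
  replace (u + v / 2) with (minus (u * 1 + v * 1 ^ 2 / 2) (u * 0 + v * 0 ^ 2 / 2))
    by (unfold minus, plus, opp; simpl; field).
  apply (is_RInt_derive (fun t => u * t + v * t ^ 2 / 2)).
  - intros t _; auto_derive; [exact I|field].
  - intros t _; apply (ex_derive_continuous (V := R_NormedModule)); auto_derive; exact I. }
destruct A as [a1 a2], B as [b1 b2].
replace ((a1, a2) + (b1, b2) / 2)%C with ((a1 + b1 / 2, a2 + b2 / 2) : C)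
  by (unfold Cplus, Cdiv, Cmult, Cinv; simpl; f_equal; field).
apply (is_RInt_fct_extend_pair (U := R_NormedModule) (V := R_NormedModule)); simpl.
- apply (is_RInt_ext (fun t => a1 + t * b1)); [|apply L].
  intros; simpl; ring.
- apply (is_RInt_ext (fun t => a2 + t * b2)); [|apply L].
  intros; simpl; ring.
Qed.

(** The affine function al + be w has the primitive al w + be w^2 / 2, so its integral is an
    increment, and increments cancel around a closed polygon. Only the deviation from the affine
    function is estimated. *)
Lemma seg_int_approx (f : C -> C) (a b al be : C) (M : R) : seg_cont f a b ->
  (forall t, 0 <= t <= 1 ->
     Cmod (f (seg a b t) - (al + be * seg a b t)) <= M) ->
  Cmod (seg_int f a b - (al * (b - a) + be * (b * b - a * a) / 2))
    <= M * Cmod (b - a).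
Proof.
intros Hc HM.
assert (H := is_RInt_minus _ _ _ _ _ _ (seg_int_correct f a b Hc)
  (is_cint_affine ((al + be * a) * (b - a))%C (be * (b - a) * (b - a))%C)).
apply norm_RInt_le_const with (M := M * Cmod (b - a)) in H; [|lra|].
- rewrite Rminus_0_r, Rmult_1_l, <- Cmod_norm in H.
  replace (seg_int f a b - (al * (b - a) + be * (b * b - a * a) / 2))%C
    with (seg_int f a b -
      ((al + be * a) * (b - a) + be * (b - a) * (b - a) / 2))%C by field.
  exact H.
- intros t Ht; rewrite <- Cmod_norm.
  replace (minus _ _)
    with ((f (seg a b t) - (al + be * seg a b t)) * (b - a))%C.
  + rewrite Cmod_mult; apply Rmult_le_compat_r; [apply Cmod_ge_0|auto].
  + unfold minus, seg; change plus with Cplus; change opp with Copp; ring.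
Qed.

Lemma seg_int_approx_const (f : C -> C) (a b c : C) (M : R) : seg_cont f a b ->
  (forall t, 0 <= t <= 1 -> Cmod (f (seg a b t) - c) <= M) ->
  Cmod (seg_int f a b - c * (b - a)) <= M * Cmod (b - a).
Proof.
intros Hc HM.
replace (c * (b - a))%C with (c * (b - a) + 0 * (b * b - a * a) / 2)%C by field.
apply seg_int_approx; [exact Hc|]; intros t Ht.
replace (c + 0 * seg a b t)%C with c by ring; auto.
Qed.

Lemma seg_int_swap (f : C -> C) (a b : C) : seg_cont f a b ->
  seg_int f b a = (- seg_int f a b)%C.
Proof.
intros H; apply seg_int_unique.
assert (K := is_RInt_swap _ _ _ _ (seg_int_correct f a b H)).
(* The bounds become the values of [-1 * t + 1] at 0 and 1, the shape that [is_RInt_comp_lin]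
   expects. *)
replace 1 with (-1 * 0 + 1) in K at 1 by ring.
replace 0 with (-1 * 1 + 1) in K at 2 by ring.
apply is_RInt_comp_lin in K.
refine (is_cint_ext _ _ _ _ _ _ K); intros t.
rewrite scal_R_Cmult.
replace (seg a b (-1 * t + 1)) with (seg b a t)
  by (unfold seg; rewrite RtoC_plus, RtoC_mult; ring).
ring.
Qed.

Lemma seg_int_split (f : C -> C) (a b : C) : seg_cont f a b ->
  seg_int f a b = (seg_int f a ((a + b) / 2) + seg_int f ((a + b) / 2) b)%C.
Proof.
intros H.
(* The values [k = 0] and [k = / 2] give the two halves. The unscaled integral is for Chasles'
   relation; the rescaled one is an integral along a half segment. *)
assert (Hk : forall k : R, 0 <= k <= / 2 -> exists l,
  is_cint (fun t => (f (seg a b t) * (b - a))%C) k (k + / 2) l /\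
  is_cint (fun t => (f (seg a b (/ 2 * t + k)) * ((b - a) / 2))%C) 0 1 l).
{ intros k Hk.
  assert (E : ex_RInt (V := C_R_CompleteNormedModule)
    (fun t => (f (seg a b t) * (b - a))%C) k (k + / 2)).
  { apply ex_RInt_Chasles_2 with 0; [lra|].
    apply ex_RInt_Chasles_1 with 1; [lra|].
    eexists; apply (seg_int_correct f a b H). }
  destruct E as [l Hl]; exists l; split; [exact Hl|].
  replace k with (/ 2 * 0 + k) in Hl at 1 by ring.
  replace (k + / 2) with (/ 2 * 1 + k) in Hl by ring.
  apply is_RInt_comp_lin in Hl.
  refine (is_cint_ext _ _ _ _ _ _ Hl); intros t.
  rewrite scal_R_Cmult, RtoC_inv by lra; field. }
destruct (Hk 0) as [l [H1 H2]]; [lra|].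
destruct (Hk (/ 2)) as [m [H3 H4]]; [lra|].
rewrite Rplus_0_l in H1; replace (/ 2 + / 2) with 1 in H3 by field.
apply seg_int_unique.
assert (E1 : seg_int f a ((a + b) / 2) = l).
{ apply seg_int_unique; refine (is_cint_ext _ _ _ _ _ _ H2); intros t.
  replace (seg a b (/ 2 * t + 0)) with (seg a ((a + b) / 2) t).
  - field.
  - unfold seg; rewrite RtoC_plus, RtoC_mult, RtoC_inv by lra; field. }
assert (E2 : seg_int f ((a + b) / 2) b = m).
{ apply seg_int_unique; refine (is_cint_ext _ _ _ _ _ _ H4); intros t.
  replace (seg a b (/ 2 * t + / 2)) with (seg ((a + b) / 2) b t).
  - field.
  - unfold seg; rewrite RtoC_plus, RtoC_mult, RtoC_inv by lra; field. }
rewrite E1, E2.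
apply (is_RInt_Chasles _ _ _ _ _ _ H1 H3).
Qed.

(** * Goursat's lemma *)

Definition convex (U : C -> Prop) : Prop :=
  forall a b t, U a -> U b -> 0 <= t <= 1 -> U (seg a b t).

(** Closedness in the form needed for nested triangles: their limit point must belong to [U], where
    [f] is differentiable. *)
Definition seq_closed (U : C -> Prop) : Prop :=
  forall p, (forall eps, 0 < eps -> exists w, U w /\ Cmod (w - p) < eps) -> U p.

(** The derivative is taken in the plane even at boundary points of [U], which yields the planar
    continuity asked by [seg_cont]. *)
Definition diff_on (U : C -> Prop) (f : C -> C) : Prop :=
  forall z, U z -> exists l, cderive f z l.

Lemma diff_on_seg_cont (U : C -> Prop) (f : C -> C) (a b : C) :
  convex U -> diff_on U f -> U a -> U b -> seg_cont f a b.
Proof.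
intros HU Hf Ha Hb t Ht; destruct (Hf (seg a b t)) as [l Hl]; [now apply HU|].
exact (cderive_ccont _ _ _ Hl).
Qed.

Lemma convex_mid (U : C -> Prop) (a b : C) :
  convex U -> U a -> U b -> U ((a + b) / 2)%C.
Proof.
intros HU Ha Hb; replace ((a + b) / 2)%C with (seg a b (/ 2)).
- apply HU; auto; lra.
- unfold seg; rewrite RtoC_inv by lra; field.
Qed.

Lemma Un_cv_dist_le (u : nat -> R) (x y e : R) :
  Un_cv u x -> (forall n, Rabs (u n - y) <= e) -> Rabs (x - y) <= e.
Proof.
intros Hx Hb; apply le_epsilon; intros d Hd.
destruct (Hx d Hd) as [N HN]; specialize (HN N (le_n N)); specialize (Hb N).
unfold Rdist in HN.
replace (x - y) with ((u N - y) - (u N - x)) by ring.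
apply Rle_trans with (1 := Rabs_triang _ _); rewrite Rabs_Ropp; lra.
Qed.

Lemma pow_half_small (k eps : R) : 0 <= k -> 0 < eps ->
  exists n, k * (/ 2) ^ n < eps.
Proof.
intros Hk He.
destruct (pow_lt_1_zero (/ 2)) with (y := eps / (k + 1)) as [n Hn].
- rewrite Rabs_pos_eq; lra.
- apply Rdiv_lt_0_compat; lra.
- exists n; specialize (Hn n (le_n n)).
  assert (P : 0 < (/ 2) ^ n) by (apply pow_lt; lra).
  rewrite Rabs_pos_eq in Hn by lra.
  apply Rle_lt_trans with ((k + 1) * (/ 2) ^ n); [apply Rmult_le_compat_r; lra|].
  apply (Rmult_lt_compat_l (k + 1)) in Hn; [|lra].
  replace ((k + 1) * (eps / (k + 1))) with eps in Hn by (field; lra); exact Hn.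
Qed.

(** Completeness is applied to [fst] and [snd], which are 1-Lipschitz; recombining the coordinates
    costs the factor 2. *)
Lemma C_geometric_limit (u : nat -> C) (d : R) : 0 <= d ->
  (forall n, Cmod (u (S n) - u n) <= d / 2 * (/ 2) ^ n) ->
  exists p, forall n, Cmod (u n - p) <= 2 * (d * (/ 2) ^ n).
Proof.
intros Hd Hu.
(* The sum of [k] consecutive steps from index [n] on, in closed form. *)
assert (B : forall n k, Cmod (u (k + n)%nat - u n) <= d * (/ 2) ^ n * (1 - (/ 2) ^ k)).
{ intros n; induction k as [|k IH].
  - simpl; rewrite Csub_diag; right; ring.
  - apply Rle_trans with (1 := Cmod_sub_triangle _ (u (k + n)%nat) _).
    specialize (Hu (k + n)%nat); rewrite pow_add in Hu.
    simpl (S k + n)%nat; simpl pow; lra. }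
assert (B' : forall n m, (n <= m)%nat -> Cmod (u m - u n) <= d * (/ 2) ^ n).
{ intros n m Hm; replace m with ((m - n) + n)%nat by lia.
  apply Rle_trans with (1 := B n (m - n)%nat).
  assert (P : 0 < (/ 2) ^ (m - n)) by (apply pow_lt; lra).
  assert (Q : 0 < (/ 2) ^ n) by (apply pow_lt; lra).
  rewrite <- (Rmult_1_r (d * (/ 2) ^ n)) at 2.
  apply Rmult_le_compat_l; [apply Rmult_le_pos; lra|lra]. }
assert (K : forall c : C -> R,
  (forall z w, Rabs (c z - c w) <= Cmod (z - w)) ->
  exists l, forall n, Rabs (l - c (u n)) <= d * (/ 2) ^ n).
{ intros c Hc.
  destruct (Rcomplete.R_complete (fun n => c (u n))) as [l Hl].
  - intros e He; destruct (pow_half_small (2 * d) e) as [N HN]; [lra|lra|].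
    exists N; intros n m Hn Hm; unfold Rdist.
    apply Rle_lt_trans with (1 := Hc _ _).
    apply Rle_lt_trans with (1 := Cmod_sub_triangle _ (u N) _).
    rewrite (Cmod_sub_sym (u N)).
    generalize (B' N n Hn) (B' N m Hm); lra.
  - exists l; intros n.
    apply Un_cv_dist_le with (u := fun k => c (u (k + n)%nat)).
    + apply (CV_shift' (fun k => c (u k))), Hl.
    + intros k; apply Rle_trans with (1 := Hc _ _), B'; lia. }
destruct (K fst) as [x Hx].
{ intros z w; apply Rle_trans with (2 := Rmax_Cmod (z - w)%C), Rmax_l. }
destruct (K snd) as [y Hy].
{ intros z w; apply Rle_trans with (2 := Rmax_Cmod (z - w)%C), Rmax_r. }
exists (x, y); intros n; rewrite Cmod_sub_sym.
apply Cmod_le_2Rmax; [apply Hx|apply Hy].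
Qed.

Definition ctriangle : Type := ((C * C) * C)%type.

Definition tri_int (f : C -> C) (T : ctriangle) : C :=
  let '(a, b, c) := T in (seg_int f a b + seg_int f b c + seg_int f c a)%C.

Definition tri_in (U : C -> Prop) (T : ctriangle) : Prop :=
  let '(a, b, c) := T in U a /\ U b /\ U c.

Definition tri_size (d : R) (T : ctriangle) : Prop :=
  let '(a, b, c) := T in
  Cmod (b - a) <= d /\ Cmod (c - b) <= d /\ Cmod (a - c) <= d.

(** One vertex suffices to locate a triangle, since [tri_size] bounds its distance to the other
    two. *)
Definition apex (T : ctriangle) : C := fst (fst T).

Lemma seg_int_swap_on (U : C -> Prop) (f : C -> C) (a b : C) :
  convex U -> diff_on U f -> U a -> U b -> seg_int f b a = (- seg_int f a b)%C.
Proof.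
intros HU Hf Ha Hb; apply seg_int_swap, (diff_on_seg_cont U); assumption.
Qed.

(** The midpoints cut the triangle into three corner triangles and a central one. Each midline is
    run through twice, in opposite directions, so the four integrals add up to that of the whole
    triangle and one of them carries at least a quarter of its modulus. *)
Lemma triangle_subdivision (U : C -> Prop) (f : C -> C) (d : R) (T : ctriangle) :
  convex U -> diff_on U f -> tri_in U T -> tri_size d T ->
  exists T', tri_in U T' /\ tri_size (d / 2) T' /\
    Cmod (apex T' - apex T) <= d / 2 /\
    Cmod (tri_int f T) <= 4 * Cmod (tri_int f T').
Proof.
destruct T as [[a b] c]; intros HU Hf [Ha [Hb Hc]] [D1 [D2 D3]].
assert (Hab := convex_mid U a b HU Ha Hb).
assert (Hbc := convex_mid U b c HU Hb Hc).
assert (Hca := convex_mid U c a HU Hc Ha).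
assert (SC := fun a b => diff_on_seg_cont U f a b HU Hf).
assert (SW := fun a b => seg_int_swap_on U f a b HU Hf).
assert (I1 := seg_int_split f a b (SC a b Ha Hb)).
assert (I2 := seg_int_split f b c (SC b c Hb Hc)).
assert (I3 := seg_int_split f c a (SC c a Hc Ha)).
assert (S1 := SW _ _ Hab Hbc); assert (S2 := SW _ _ Hbc Hca).
assert (S3 := SW _ _ Hca Hab).
assert (half : forall x y : C, (x = y / 2 \/ x = - (y / 2))%C ->
  Cmod y <= d -> Cmod x <= d / 2).
{ intros x y [-> | ->] Hy; rewrite ?Cmod_opp, Cmod_div by (intros E; injection E; lra);
  rewrite Cmod_R, (Rabs_pos_eq 2) by lra; lra. }
set (x := ((a + b) / 2)%C) in *; set (y := ((b + c) / 2)%C) in *.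
set (z := ((c + a) / 2)%C) in *.
set (T1 := (a, x, z) : ctriangle); set (T2 := (x, b, y) : ctriangle).
set (T3 := (z, y, c) : ctriangle); set (T4 := (x, y, z) : ctriangle).
assert (Hsum : tri_int f (a, b, c) =
  (tri_int f T1 + tri_int f T2 + tri_int f T3 + tri_int f T4)%C).
{ unfold tri_int, T1, T2, T3, T4; rewrite I1, I2, I3, S1, S2, S3; ring. }
assert (G : exists T', (T' = T1 \/ T' = T2 \/ T' = T3 \/ T' = T4) /\
  Cmod (tri_int f (a, b, c)) <= 4 * Cmod (tri_int f T')).
{ assert (N : Cmod (tri_int f (a, b, c)) <= Cmod (tri_int f T1) +
    Cmod (tri_int f T2) + Cmod (tri_int f T3) + Cmod (tri_int f T4)).
  { rewrite Hsum.
    apply Rle_trans with (1 := Cmod_triangle _ _), Rplus_le_compat_r.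
    apply Rle_trans with (1 := Cmod_triangle _ _), Rplus_le_compat_r.
    apply Cmod_triangle. }
  set (m := Cmod (tri_int f (a, b, c))) in *.
  destruct (Rle_dec m (4 * Cmod (tri_int f T1))); [now exists T1; auto|].
  destruct (Rle_dec m (4 * Cmod (tri_int f T2))); [now exists T2; auto|].
  destruct (Rle_dec m (4 * Cmod (tri_int f T3))); [now exists T3; auto|].
  exists T4; split; [auto|lra]. }
assert (Z : Cmod (a - a) <= d / 2).
{ rewrite Csub_diag; generalize (Cmod_ge_0 (b - a)); lra. }
destruct G as [T' [HT' Hle]]; exists T'.
(* Each side of a small triangle, and each nonzero displacement of the apex, is plus or minus half a
   side of the large one. *)
assert (M : tri_in U T' /\ tri_size (d / 2) T' /\ Cmod (apex T' - a) <= d / 2).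
{ destruct HT' as [-> | [-> | [-> | ->]]]; unfold T1, T2, T3, T4, apex; simpl;
  (split; [repeat split; assumption|]); (split; [repeat split|]);
  try exact Z; unfold x, y, z;
  solve [ apply (half _ (b - a)%C); [(left; field) || (right; field)|exact D1]
        | apply (half _ (c - b)%C); [(left; field) || (right; field)|exact D2]
        | apply (half _ (a - c)%C); [(left; field) || (right; field)|exact D3] ]. }
destruct M as [M1 [M2 M3]]; repeat split; assumption.
Qed.

Lemma triangle_nested (U : C -> Prop) (f : C -> C) (d : R) (T0 : ctriangle) :
  convex U -> diff_on U f -> tri_in U T0 -> tri_size d T0 ->
  exists T : nat -> ctriangle, T O = T0 /\ forall n,
    tri_in U (T n) /\ tri_size (d * (/ 2) ^ n) (T n) /\
    Cmod (apex (T (S n)) - apex (T n)) <= d / 2 * (/ 2) ^ n /\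
    Cmod (tri_int f T0) <= 4 ^ n * Cmod (tri_int f (T n)).
Proof.
intros HU Hf Hin Hsz.
set (P := fun n T => tri_in U T /\ tri_size (d * (/ 2) ^ n) T /\
  Cmod (tri_int f T0) <= 4 ^ n * Cmod (tri_int f T)).
set (Q := fun n T T' => Cmod (apex T' - apex T) <= d / 2 * (/ 2) ^ n).
(* Dependent choice: a state is a triangle packed with its invariants [P n], so that the recursion
   can invoke the choice at every stage. *)
assert (step : forall n (x : {T | P n T}),
  {y : {T | P (S n) T} | Q n (proj1_sig x) (proj1_sig y)}).
{ intros n [T [H1 [H2 H3]]]; apply constructive_indefinite_description.
  destruct (triangle_subdivision U f _ T HU Hf H1 H2) as [T' [K1 [K2 [K3 K4]]]].
  assert (PT : P (S n) T').
  { split; [exact K1|split].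
    - replace (d * (/ 2) ^ S n) with (d * (/ 2) ^ n / 2) by (simpl; field).
      exact K2.
    - apply Rle_trans with (1 := H3); simpl pow.
      assert (0 < 4 ^ n) by (apply pow_lt; lra).
      apply Rle_trans with (4 ^ n * (4 * Cmod (tri_int f T'))); [|right; ring].
      apply Rmult_le_compat_l; lra. }
  exists (exist _ T' PT); unfold Q; simpl.
  apply Rle_trans with (1 := K3); right; field. }
assert (P0 : P O T0).
{ split; [exact Hin|split; simpl; [now rewrite Rmult_1_r|lra]]. }
set (x := fix x n : {T | P n T} :=
  match n with O => exist _ T0 P0 | S m => proj1_sig (step m (x m)) end).
exists (fun n => proj1_sig (x n)); split; [reflexivity|]; intros n.
destruct (proj2_sig (x n)) as [H1 [H2 H3]].
split; [exact H1|split; [exact H2|split; [|exact H3]]].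
exact (proj2_sig (step n (x n))).
Qed.

Lemma seg_near (a b q : C) (t r : R) : 0 <= t <= 1 ->
  Cmod (a - q) <= r -> Cmod (b - q) <= r -> Cmod (seg a b t - q) <= r.
Proof.
intros Ht Ha Hb; unfold seg.
replace (a + t * (b - a) - q)%C
  with (RtoC (1 - t) * (a - q) + RtoC t * (b - q))%C by (rewrite RtoC_minus; ring).
apply Rle_trans with (1 := Cmod_triangle _ _).
rewrite !Cmod_mult, !Cmod_R, !Rabs_pos_eq by lra.
assert (A := Rmult_le_compat_l (1 - t) _ _ ltac:(lra) Ha).
assert (B := Rmult_le_compat_l t _ _ ltac:(lra) Hb); lra.
Qed.

Lemma convex_cball (q : C) (r : R) : convex (fun w => Cmod (w - q) <= r).
Proof. intros a b t Ha Hb Ht; now apply seg_near. Qed.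

Lemma seq_closed_cball (q : C) (r : R) : seq_closed (fun w => Cmod (w - q) <= r).
Proof.
intros p H; apply le_epsilon; intros e He; destruct (H e He) as [w [Hw Hp]].
generalize (Cmod_sub_triangle p w q); rewrite (Cmod_sub_sym p w); lra.
Qed.

(** At the limit point [p] of the nested triangles, [f] is affine up to e |w - p|. The affine part
    integrates to zero around the n-th triangle, whose size is [q = d * (/ 2) ^ n], so its integral
    is O(e q^2); the factor 4^n lost by subdivision is compensated by q^2. *)
Lemma goursat (U : C -> Prop) (f : C -> C) (a b c : C) :
  convex U -> seq_closed U -> diff_on U f -> U a -> U b -> U c ->
  (seg_int f a b + seg_int f b c + seg_int f c a)%C = RtoC 0.
Proof.
intros HU HcU Hf Ha Hb Hc.
change (tri_int f (a, b, c) = RtoC 0).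
set (d := Cmod (b - a) + Cmod (c - b) + Cmod (a - c)).
assert (N1 := Cmod_ge_0 (b - a)); assert (N2 := Cmod_ge_0 (c - b)).
assert (N3 := Cmod_ge_0 (a - c)).
assert (Hd : 0 <= d) by (unfold d; lra).
destruct (triangle_nested U f d (a, b, c)) as [T [_ HT]]; auto.
{ now split. }
{ repeat split; unfold d; lra. }
destruct (C_geometric_limit (fun n => apex (T n)) d) as [p Hp]; [exact Hd|apply HT|].
assert (Up : U p).
{ apply HcU; intros e He.
  destruct (pow_half_small (2 * d) e) as [n Hn]; [lra|exact He|].
  exists (apex (T n)); split.
  - destruct (HT n) as [Hin _]; destruct (T n) as [[u v] w]; apply Hin.
  - specialize (Hp n); simpl in Hp; lra. }
destruct (Hf p Up) as [l Hl].
apply Cmod_eq_0, Rle_antisym; [|apply Cmod_ge_0].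
(* Three sides of length at most q, each with integrand at most 3 q e: the triangle lies within 3 q
   of [p], namely 2 q for its apex and q more for the other vertices. *)
apply le_epsilon_mult with (k := 9 * d * d).
{ repeat apply Rmult_le_pos; lra. }
intros e He.
destruct (proj1 (cderive_iff f p l) Hl e He) as [dl [Hdl Hfl]].
destruct (pow_half_small (3 * d) dl) as [n Hn]; [lra|exact Hdl|].
destruct (HT n) as [Hin [Hsz [_ Hle]]]; specialize (Hp n); simpl in Hp.
set (q := d * (/ 2) ^ n) in *.
apply Rle_trans with (1 := Hle).
assert (P4 : 0 < 4 ^ n) by (apply pow_lt; lra).
assert (E4 : 4 ^ n * (q * q) = d * d).
{ unfold q; replace (4 ^ n * (d * (/ 2) ^ n * (d * (/ 2) ^ n)))
    with (4 ^ n * ((/ 2) ^ n * (/ 2) ^ n) * (d * d)) by ring.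
  rewrite <- !Rpow_mult_distr; replace (4 * (/ 2 * / 2)) with 1 by field.
  rewrite pow1; ring. }
replace (9 * d * d * e) with (4 ^ n * (9 * e * (q * q)))
  by (transitivity (9 * e * (d * d)); [rewrite <- E4|]; ring).
apply Rmult_le_compat_l; [lra|].
destruct (T n) as [[u v] w].
destruct Hin as [Hu [Hv Hw]], Hsz as [S1 [S2 S3]]; unfold apex in Hp; simpl in Hp.
assert (Q : 0 <= q) by (generalize (Cmod_ge_0 (v - u)); lra).
assert (Hvp : Cmod (v - p) <= 3 * q) by (generalize (Cmod_sub_triangle v u p); lra).
assert (Hwp : Cmod (w - p) <= 3 * q).
{ generalize (Cmod_sub_triangle w u p); rewrite (Cmod_sub_sym w u); lra. }
assert (Hup : Cmod (u - p) <= 3 * q) by lra.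
assert (K : forall x y, U x -> U y -> Cmod (x - p) <= 3 * q ->
  Cmod (y - p) <= 3 * q -> Cmod (y - x) <= q ->
  Cmod (seg_int f x y - ((f p - l * p) * (y - x) + l * (y * y - x * x) / 2))
    <= 3 * e * (q * q)).
{ intros x y Hx Hy Hxp Hyp Hxy.
  apply Rle_trans with (3 * q * e * Cmod (y - x)).
  - apply seg_int_approx; [now apply (diff_on_seg_cont U)|].
    intros t Ht; assert (Hs := seg_near x y p t (3 * q) Ht Hxp Hyp).
    replace (f (seg x y t) - (f p - l * p + l * seg x y t))%C
      with (f (seg x y t) - f p - l * (seg x y t - p))%C by ring.
    assert (Hlt : Cmod (seg x y t - p) < dl) by (unfold q in Hs; lra).
    apply Rle_trans with (1 := Hfl _ Hlt).
    replace (3 * q * e) with (e * (3 * q)) by ring; apply Rmult_le_compat_l; lra.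
  - replace (3 * e * (q * q)) with (3 * q * e * q) by ring.
    apply Rmult_le_compat_l; [apply Rmult_le_pos; lra|exact Hxy]. }
assert (K1 := K u v Hu Hv Hup Hvp S1); assert (K2 := K v w Hv Hw Hvp Hwp S2).
assert (K3 := K w u Hw Hu Hwp Hup S3); unfold tri_int.
replace (seg_int f u v + seg_int f v w + seg_int f w u)%C with
 ((seg_int f u v - ((f p - l * p) * (v - u) + l * (v * v - u * u) / 2)) +
  (seg_int f v w - ((f p - l * p) * (w - v) + l * (w * w - v * v) / 2)) +
  (seg_int f w u - ((f p - l * p) * (u - w) + l * (u * u - w * w) / 2)))%C by field.
apply Rle_trans with (1 := Cmod_triangle _ _).
apply Rle_trans with (3 * e * (q * q) + 3 * e * (q * q) + 3 * e * (q * q)); [|lra].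
apply Rplus_le_compat; [|exact K3].
apply Rle_trans with (1 := Cmod_triangle _ _); lra.
Qed.

Lemma holo_diff_on (f : C -> C) (r : R) : holo f -> r < 1 ->
  diff_on (fun w => Cmod (w - 0) <= r) f.
Proof.
intros Hf Hr z Hz; apply Hf; unfold unit_disc.
replace z with (z - 0)%C by ring; lra.
Qed.

Lemma cderive_seg_int (h : C -> C) (z : C) : holo h -> unit_disc z ->
  cderive (seg_int h 0) z (h z).
Proof.
unfold unit_disc; intros Hh Hz; set (r := (1 + Cmod z) / 2).
assert (Hr : r < 1) by (unfold r; lra).
assert (P := Cmod_ge_0 z).
assert (Hd := holo_diff_on h r Hh Hr).
(* Goursat's lemma asks for a closed convex set: the disc of radius half-way between |z| and 1
   contains 0, [z] and all [w] near [z]. *)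
set (U := fun w => Cmod (w - 0) <= r) in *.
assert (HU : convex U) by apply convex_cball.
assert (U0 : U (RtoC 0)) by (unfold U; rewrite Csub_diag; unfold r; lra).
assert (Uz : U z).
{ unfold U; replace (z - 0)%C with z by ring; unfold r; lra. }
apply cderive_iff; intros e He.
destruct (Hd z Uz) as [l Hl].
destruct (cderive_ccont _ _ _ Hl e He) as [d [Hd0 Hde]].
exists (Rmin d (r - Cmod z)); split.
{ apply Rmin_glb_lt; [exact Hd0|unfold r; lra]. }
intros w Hw.
assert (W1 := Rlt_le_trans _ _ _ Hw (Rmin_l _ _)).
assert (W2 := Rlt_le_trans _ _ _ Hw (Rmin_r _ _)).
assert (Uw : U w).
{ unfold U; replace (w - 0)%C with w by ring.
  generalize (Cmod_le_sub w z); lra. }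
assert (G := goursat U h 0 z w HU (seq_closed_cball 0 r) Hd U0 Uz Uw).
rewrite (seg_int_swap h 0 w (diff_on_seg_cont U _ _ _ HU Hd U0 Uw)) in G.
replace (seg_int h 0 w - seg_int h 0 z)%C with (seg_int h z w).
- apply seg_int_approx_const; [exact (diff_on_seg_cont U _ _ _ HU Hd Uz Uw)|].
  intros t Ht; left; apply Hde.
  apply Rle_lt_trans with (2 := W1), seg_near; [exact Ht| |lra].
  rewrite Csub_diag; apply Cmod_ge_0.
- replace (seg_int h z w) with (seg_int h 0 z + seg_int h z w
    + - seg_int h 0 w + (seg_int h 0 w - seg_int h 0 z))%C by ring.
  rewrite G; ring.
Qed.

(** * Cauchy's estimate *)

Definition cexp (u : C) : C := (exp (fst u) * cos (snd u), exp (fst u) * sin (snd u)).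

Lemma cexp_plus (u v : C) : cexp (u + v) = (cexp u * cexp v)%C.
Proof.
destruct u as [a b], v as [c d]; unfold cexp, Cmult, Cplus; simpl.
rewrite exp_plus, cos_plus, sin_plus; f_equal; ring.
Qed.

Lemma Cmod_cexp (u : C) : Cmod (cexp u) = exp (fst u).
Proof.
assert (P := exp_pos (fst u)).
unfold cexp, Cmod; simpl fst; simpl snd.
replace ((exp (fst u) * cos (snd u)) ^ 2 + (exp (fst u) * sin (snd u)) ^ 2)
  with (Rsqr (exp (fst u))).
- now apply sqrt_Rsqr, Rlt_le.
- transitivity (Rsqr (exp (fst u)) * (Rsqr (sin (snd u)) + Rsqr (cos (snd u)))).
  + rewrite sin2_cos2; ring.
  + unfold Rsqr; ring.
Qed.

Lemma cexp_neq0 (u : C) : cexp u <> RtoC 0.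
Proof. apply Cmod_gt_0; rewrite Cmod_cexp; apply exp_pos. Qed.

Lemma cexp_period (u : C) : cexp (u + (0, 2 * PI)) = cexp u.
Proof.
rewrite cexp_plus; unfold cexp at 2; simpl; rewrite exp_0, cos_2PI, sin_2PI.
rewrite Rmult_0_r, Rmult_1_r; apply Cmult_1_r.
Qed.

Lemma derivable_pt_lim_0_le (f : R -> R) (l : R) : derivable_pt_lim f 0 l ->
  forall e, 0 < e -> exists d, 0 < d /\ forall h, Rabs h < d ->
    Rabs (f h - f 0 - l * h) <= e * Rabs h.
Proof.
intros H e He; destruct (H e He) as [d Hd]; exists d; split; [apply cond_pos|].
intros h Hh; destruct (Req_dec h 0) as [->|Hn].
- replace (f 0 - f 0 - l * 0) with 0 by ring; rewrite Rabs_R0; lra.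
- specialize (Hd h Hn Hh); rewrite Rplus_0_l in Hd.
  replace (f h - f 0 - l * h) with (((f h - f 0) / h - l) * h) by (field; auto).
  rewrite Rabs_mult; apply Rmult_le_compat_r; [apply Rabs_pos|lra].
Qed.

(** With w = x + i y, the real error is exp x (cos y - 1) + (exp x - 1 - x) and the imaginary one
    exp x (sin y - y) + (exp x - 1) y, which reduces the claim to the three real derivatives at
    0. *)
Lemma cderive_cexp_0 : cderive cexp (RtoC 0) (RtoC 1).
Proof.
apply cderive_iff; intros e He.
(* Each coordinate of the error is at most 5 k |w|, and [Cmod_le_2Rmax] doubles this; [k <= 1]
   ensures exp x <= 3. *)
set (k := Rmin 1 (e / 10)).
assert (Hk : 0 < k) by (apply Rmin_glb_lt; lra).
assert (Hk1 : k <= 1) by apply Rmin_l.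
assert (Hke : 10 * k <= e) by (generalize (Rmin_r 1 (e / 10)); fold k; lra).
clearbody k.
destruct (derivable_pt_lim_0_le exp 1 derivable_pt_lim_exp_0 k Hk) as [d1 [P1 H1]].
assert (Ds := derivable_pt_lim_sin 0); rewrite cos_0 in Ds.
assert (Dc := derivable_pt_lim_cos 0); rewrite sin_0, Ropp_0 in Dc.
destruct (derivable_pt_lim_0_le sin 1 Ds k Hk) as [d2 [P2 H2]].
destruct (derivable_pt_lim_0_le cos 0 Dc k Hk) as [d3 [P3 H3]].
exists (Rmin k (Rmin d1 (Rmin d2 d3))); split.
{ repeat apply Rmin_glb_lt; assumption. }
intros w; replace (w - 0)%C with w by ring; intros Hw.
assert (W0 := Rlt_le_trans _ _ _ Hw (Rmin_l _ _)).
assert (W := Rlt_le_trans _ _ _ Hw (Rmin_r _ _)).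
assert (W1 := Rlt_le_trans _ _ _ W (Rmin_l _ _)).
assert (W' := Rlt_le_trans _ _ _ W (Rmin_r _ _)).
assert (W2 := Rlt_le_trans _ _ _ W' (Rmin_l _ _)).
assert (W3 := Rlt_le_trans _ _ _ W' (Rmin_r _ _)).
assert (Hx : Rabs (fst w) <= Cmod w)
  by apply Rle_trans with (2 := Rmax_Cmod w), Rmax_l.
assert (Hy : Rabs (snd w) <= Cmod w)
  by apply Rle_trans with (2 := Rmax_Cmod w), Rmax_r.
set (N := Cmod w) in *.
specialize (H1 (fst w) ltac:(lra)); specialize (H2 (snd w) ltac:(lra)).
specialize (H3 (snd w) ltac:(lra)).
rewrite exp_0 in H1; rewrite sin_0 in H2; rewrite cos_0 in H3.
assert (Ex : Rabs (exp (fst w)) <= 3).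
{ assert (P := exp_pos (fst w)); rewrite Rabs_pos_eq by lra.
  apply Rle_trans with (2 := exp_le_3).
  destruct (Rle_lt_or_eq_dec (fst w) 1) as [L|L].
  - generalize (Rle_abs (fst w)); lra.
  - left; now apply exp_increasing.
  - rewrite L; lra. }
assert (Hx0 := Rabs_pos (fst w)); assert (Hy0 := Rabs_pos (snd w)).
assert (X1 := Rmult_le_compat_l k _ _ ltac:(lra) Hx).
assert (Y1 := Rmult_le_compat_l k _ _ ltac:(lra) Hy).
assert (KN : 0 <= k * N) by (apply Rmult_le_pos; lra).
assert (Em : Rabs (exp (fst w) - 1) <= 2 * k).
{ replace (exp (fst w) - 1) with ((exp (fst w) - 1 - 1 * fst w) + fst w) by ring.
  apply Rle_trans with (1 := Rabs_triang _ _).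
  assert (k * N <= 1 * N) by (apply Rmult_le_compat_r; lra); lra. }
apply Rle_trans with (2 * (5 * k * N)).
- destruct w as [x y]; simpl fst in *; simpl snd in *.
  apply Cmod_le_2Rmax; unfold cexp, Cminus, Cplus, Copp, Cmult, RtoC; simpl.
  + replace (exp x * cos y + - (exp 0 * cos 0) + - (1 * x - 0 * y))
      with (exp x * (cos y - 1 - 0 * y) + (exp x - 1 - 1 * x))
      by (rewrite exp_0, cos_0; ring).
    apply Rle_trans with (1 := Rabs_triang _ _); rewrite Rabs_mult.
    assert (Rabs (exp x) * Rabs (cos y - 1 - 0 * y) <= 3 * (k * N)).
    { apply Rmult_le_compat; try apply Rabs_pos; lra. }
    lra.
  + replace (exp x * sin y + - (exp 0 * sin 0) + - (1 * y + 0 * x))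
      with (exp x * (sin y - 0 - 1 * y) + (exp x - 1) * y)
      by (rewrite exp_0, sin_0; ring).
    apply Rle_trans with (1 := Rabs_triang _ _); rewrite !Rabs_mult.
    assert (Rabs (exp x) * Rabs (sin y - 0 - 1 * y) <= 3 * (k * N)).
    { apply Rmult_le_compat; try apply Rabs_pos; lra. }
    assert (Rabs (exp x - 1) * Rabs y <= 2 * k * N).
    { apply Rmult_le_compat; try apply Rabs_pos; lra. }
    lra.
- replace (2 * (5 * k * N)) with (10 * k * N) by ring.
  apply Rmult_le_compat_r; lra.
Qed.

Lemma cderive_cexp (u : C) : cderive cexp u (cexp u).
Proof.
assert (S : cderive (fun w => w + - u)%C u (1 + 0)%C).
{ apply cderive_plus; [apply cderive_id|apply cderive_const]. }
assert (E : cderive (fun w => cexp (w + - u)) u (1 * (1 + 0))%C).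
{ apply (cderive_comp cexp (fun w => w + - u)%C u 1 (1 + 0)%C S).
  rewrite Cplus_opp_r; apply cderive_cexp_0. }
assert (M := cderive_mult _ _ _ _ _ (cderive_const (cexp u) u) E).
apply (cderive_local (fun w => cexp u * cexp (w + - u))%C cexp u _ 1 Rlt_0_1).
- intros w _; rewrite <- cexp_plus; f_equal; ring.
- apply (cderive_eq _ _ _ _ M); ring.
Qed.

(* In the coordinate [w = z + exp u], the circles around [z] become vertical
   segments of length 2 pi and the horizontal sides of a rectangle carry the
   same integrals by periodicity; Goursat's lemma on the half-plane
   [Re u <= ln r] then moves the outer circle into the centre. *)
Lemma cauchy_estimate (F : C -> C) (z l : C) (r M : R) : 0 < r ->
  diff_on (fun w => Cmod (w - z) <= r) F ->
  (forall w, Cmod (w - z) <= r -> Cmod (F w) <= M) ->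
  cderive F z l -> Cmod l <= 2 * M / r.
Proof.
intros Hr HF HM Hl.
set (U := fun u : C => fst u <= ln r).
(* With w = z + cexp u, [Phi u] du is (F w - F z) / (w - z)^2 dw. Thanks to the subtraction of
   [F z], [Phi] tends to [l] as Re u tends to minus infinity. *)
set (Phi := fun u => ((F (z + cexp u) + - F z) * / cexp u)%C).
set (P := (0, 2 * PI) : C).
assert (CU : convex U).
{ intros a b t Ha Hb Ht; unfold U, seg in *; simpl.
  replace (fst a + (t * (fst b + - fst a) - 0 * (snd b + - snd a)))
    with ((1 - t) * fst a + t * fst b) by ring.
  assert (A := Rmult_le_compat_l (1 - t) _ _ ltac:(lra) Ha).
  assert (B := Rmult_le_compat_l t _ _ ltac:(lra) Hb); lra. }
assert (SU : seq_closed U).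
{ intros p H; unfold U in *; apply le_epsilon; intros e He.
  destruct (H e He) as [w [Hw Hp]].
  assert (Rabs (fst (w - p)%C) <= Cmod (w - p))
    by apply Rle_trans with (2 := Rmax_Cmod (w - p)%C), Rmax_l.
  simpl in H0; generalize (Rle_abs (- (fst w + - fst p))); rewrite Rabs_Ropp; lra. }
assert (BU : forall u, U u -> Cmod (z + cexp u - z) <= r).
{ intros u Hu; replace (z + cexp u - z)%C with (cexp u) by ring.
  rewrite Cmod_cexp, <- (exp_ln r Hr).
  destruct (Rle_lt_or_eq_dec _ _ Hu) as [L|L].
  - left; now apply exp_increasing.
  - right; now f_equal. }
assert (DU : diff_on U Phi).
{ intros u Hu; destruct (HF _ (BU u Hu)) as [m Hm].
  eexists; apply cderive_mult.
  - apply cderive_plus; [|apply cderive_const].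
    apply (cderive_comp F (fun v => z + cexp v)%C); [|exact Hm].
    apply cderive_plus; [apply cderive_const|apply cderive_cexp].
  - apply cderive_inv; [apply cderive_cexp|apply cexp_neq0]. }
assert (Shift : forall x y : R,
  seg_int Phi (x + P) (y + P) = seg_int Phi x y).
{ intros x y; apply (RInt_ext (V := C_R_CompleteNormedModule)); intros t _.
  replace (y + P - (x + P))%C with (y - x)%C by ring; f_equal.
  replace (seg (x + P) (y + P) t) with (seg x y t + P)%C by (unfold seg; ring).
  unfold Phi, P; rewrite cexp_period; reflexivity. }
assert (UP : forall x : R, x <= ln r -> U x /\ U (x + P)%C).
{ intros x Hx; unfold U; simpl; lra. }
assert (Inv : forall x : R, x <= ln r ->
  seg_int Phi (ln r) (ln r + P) = seg_int Phi x (x + P)).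
{ intros x Hx; destruct (UP x Hx) as [A1 A2].
  destruct (UP (ln r) (Rle_refl _)) as [B1 B2].
  assert (SW := fun a b (Ha : U a) (Hb : U b) =>
    seg_int_swap Phi a b (diff_on_seg_cont U Phi a b CU DU Ha Hb)).
  (* The rectangle is cut along the diagonal from [x] to [ln r + P]; its integral [I3] and the equal
     horizontal integrals [I1] cancel. *)
  assert (G1 := goursat U Phi _ _ _ CU SU DU A1 B1 B2).
  assert (G2 := goursat U Phi _ _ _ CU SU DU A1 B2 A2).
  rewrite (SW _ _ A1 B2) in G1.
  rewrite (SW _ _ A2 B2), (SW _ _ A1 A2), Shift in G2.
  set (I1 := seg_int Phi x (ln r)) in *.
  set (I2 := seg_int Phi (ln r) (ln r + P)) in *.
  set (I3 := seg_int Phi x (ln r + P)) in *.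
  set (I4 := seg_int Phi x (x + P)) in *.
  replace I2 with (I4 + ((I1 + I2 + - I3) + (I3 + - I1 + - I4)))%C by ring.
  rewrite G1, G2; ring. }
assert (LP : forall x : R, Cmod (x + P - x) = 2 * PI).
{ intros x; replace (x + P - x)%C with P by ring.
  unfold P, Cmod; simpl fst; simpl snd.
  replace (0 ^ 2 + (2 * PI) ^ 2) with (Rsqr (2 * PI)) by (unfold Rsqr; ring).
  apply sqrt_Rsqr; generalize PI_RGT_0; lra. }
assert (Fst : forall (x t : R), fst (seg x (x + P)%C t) = x).
{ intros x t; unfold seg, P; simpl; ring. }
assert (PP := PI_RGT_0).
assert (C0 : forall x : R, x <= ln r -> seg_cont Phi x (x + P)).
{ intros x Hx; destruct (UP x Hx); now apply (diff_on_seg_cont U). }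
assert (Outer : Cmod (seg_int Phi (ln r) (ln r + P)) <= 2 * M / r * (2 * PI)).
{ replace (seg_int Phi (ln r) (ln r + P)) with
    (seg_int Phi (ln r) (ln r + P) - 0 * (ln r + P - ln r))%C by ring.
  rewrite <- (LP (ln r)).
  apply seg_int_approx_const; [apply C0; lra|]; intros t Ht.
  set (u := seg (ln r) (ln r + P) t).
  assert (Hu : fst u = ln r) by apply Fst.
  replace (Phi u - 0)%C with ((F (z + cexp u) - F z) / cexp u)%C
    by (unfold Phi; field; apply cexp_neq0).
  rewrite Cmod_div by apply cexp_neq0.
  rewrite Cmod_cexp, Hu, exp_ln by exact Hr.
  apply Rmult_le_compat_r; [left; now apply Rinv_0_lt_compat|].
  apply Rle_trans with (1 := Cmod_sub_le _ _).
  assert (H1 := HM (z + cexp u)%C (BU u ltac:(unfold U; lra))).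
  assert (H2 : Cmod (F z) <= M) by (apply HM; rewrite Csub_diag; lra).
  lra. }
apply le_epsilon; intros e He.
destruct (proj1 (cderive_iff F z l) Hl e He) as [d [Hd Hdl]].
(* The inner circle must not exceed the outer one and must lie where the difference quotient is
   within [e] of [l]; halving [d] gives the strict inequality. *)
set (s := Rmin r (d / 2)).
assert (Hs : 0 < s) by (apply Rmin_glb_lt; lra).
assert (Hsd : s < d) by (generalize (Rmin_r r (d / 2)); fold s; lra).
assert (Hsr : ln s <= ln r).
{ destruct (Rle_lt_or_eq_dec s r (Rmin_l _ _)) as [L|L].
  - left; now apply ln_increasing.
  - right; now f_equal. }
assert (Inner : Cmod (seg_int Phi (ln s) (ln s + P) - l * (ln s + P - ln s))
  <= e * (2 * PI)).
{ rewrite <- (LP (ln s)).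
  apply seg_int_approx_const; [now apply C0|]; intros t Ht.
  set (u := seg (ln s) (ln s + P) t).
  assert (Hu : fst u = ln s) by apply Fst.
  assert (Ne := cexp_neq0 u).
  assert (Hc : Cmod (cexp u) = s) by (rewrite Cmod_cexp, Hu; now apply exp_ln).
  assert (E : (z + cexp u - z)%C = cexp u) by ring.
  assert (B := Hdl (z + cexp u)%C); rewrite E, Hc in B; specialize (B Hsd).
  replace (Phi u - l)%C with ((F (z + cexp u) - F z - l * cexp u) / cexp u)%C
    by (unfold Phi; field; exact Ne).
  rewrite Cmod_div, Hc by exact Ne.
  apply Rmult_le_reg_r with s; [exact Hs|].
  unfold Rdiv; rewrite Rmult_assoc, Rinv_l, Rmult_1_r by lra; exact B. }
(* Both circles carry the same integral: it is within e (2 pi) of l times the period, and bounded by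
   (2 M / r) (2 pi). *)
rewrite <- (Inv _ Hsr) in Inner.
apply Rmult_le_reg_r with (2 * PI); [lra|].
rewrite <- (LP (ln s)) at 1; rewrite <- Cmod_mult, Rmult_plus_distr_r.
set (Q := (l * (ln s + P - ln s))%C) in *.
generalize (Cmod_le_sub Q (seg_int Phi (ln r) (ln r + P))).
rewrite (Cmod_sub_sym Q); lra.
Qed.

(** * Growth spaces *)

Lemma Rpower_small (a e : R) : 0 < a -> 0 < e ->
  exists d, 0 < d <= 1 /\ forall x, 0 < x < d -> Rpower x a <= e.
Proof.
intros Ha He; assert (P : 0 < Rpower e (/ a)) by apply exp_pos.
exists (Rmin 1 (Rpower e (/ a))); split.
- split; [apply Rmin_glb_lt; lra|apply Rmin_l].
- intros x [H1 H2].
  replace e with (Rpower (Rpower e (/ a)) a).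
  + apply Rle_Rpower_l; [lra|]; generalize (Rmin_r 1 (Rpower e (/ a))); lra.
  + rewrite Rpower_mult, Rinv_l, Rpower_1; lra.
Qed.

Lemma Rpower_gt0 (x a : R) : 0 < Rpower x a.
Proof. apply exp_pos. Qed.

Lemma Rpower_cancel (x a : R) : Rpower x a * Rpower x (- a) = 1.
Proof. rewrite Rpower_Ropp; apply Rinv_r, Rgt_not_eq, Rpower_gt0. Qed.

Lemma holo_plus (f h : C -> C) : holo f -> holo h -> holo (fun z => f z + h z)%C.
Proof.
intros Hf Hh z Hz; destruct (Hf z Hz) as [l Hl], (Hh z Hz) as [m Hm].
eexists; exact (cderive_plus _ _ _ _ _ Hl Hm).
Qed.

Lemma holo_mult (f h : C -> C) : holo f -> holo h -> holo (fun z => f z * h z)%C.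
Proof.
intros Hf Hh z Hz; destruct (Hf z Hz) as [l Hl], (Hh z Hz) as [m Hm].
eexists; exact (cderive_mult _ _ _ _ _ Hl Hm).
Qed.

Lemma holo_const (c : C) : holo (fun _ => c).
Proof. intros z _; eexists; apply cderive_const. Qed.

(** Compactness with a gauge [d] that is both a radius and, as [/ d], a local bound: a uniform lower
    bound on the gauge is then a global bound for [f]. At centres outside the disc the gauge is so
    small that no point of the disc is concerned. *)
Lemma holo_bounded (f : C -> C) (r : R) : holo f -> r < 1 ->
  exists M, 0 <= M /\ forall w, Cmod w <= r -> Cmod (f w) <= M.
Proof.
intros Hf Hr.
assert (Hloc : forall u v : R, exists d : posreal, forall w, Cmod w <= r ->
  Rabs (fst w - u) < d -> Rabs (snd w - v) < d -> Cmod (f w) <= / d).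
{ intros u v; set (q := (u, v) : C).
  (* A square of half-side d lies in the disc of radius 2 d, hence the division by 3 in both
     gauges. *)
  assert (box : forall d w, Rabs (fst w - u) < d -> Rabs (snd w - v) < d ->
    Cmod (w - q) <= 2 * d).
  { intros d w H1 H2; apply Cmod_le_2Rmax; simpl; left; assumption. }
  destruct (Rle_lt_dec (Cmod q) r) as [Hq|Hq].
  - destruct (Hf q) as [l Hl]; [unfold unit_disc; lra|].
    destruct (ccont_bounded f q (cderive_ccont _ _ _ Hl)) as [d [Hd Hfd]].
    assert (P := Cmod_ge_0 (f q)).
    assert (P' : 0 < / (Cmod (f q) + 1)) by (apply Rinv_0_lt_compat; lra).
    assert (Hm : 0 < Rmin (d / 3) (/ (Cmod (f q) + 1))) by (apply Rmin_glb_lt; lra).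
    exists (mkposreal _ Hm); simpl; intros w _ H1 H2.
    assert (B := box _ w H1 H2).
    assert (M1 := Rmin_l (d / 3) (/ (Cmod (f q) + 1))).
    assert (M2 := Rmin_r (d / 3) (/ (Cmod (f q) + 1))).
    specialize (Hfd w ltac:(lra)).
    apply Rinv_le_contravar in M2; [|exact Hm]; rewrite Rinv_inv in M2; lra.
  - assert (Hm : 0 < (Cmod q - r) / 3) by lra.
    exists (mkposreal _ Hm); simpl; intros w Hw H1 H2.
    assert (B := box _ w H1 H2).
    generalize (Cmod_le_sub q w); rewrite (Cmod_sub_sym q w); lra. }
assert (K : forall u v : R, {d : posreal | forall w, Cmod w <= r ->
  Rabs (fst w - u) < d -> Rabs (snd w - v) < d -> Cmod (f w) <= / d})
  by (intros; apply constructive_indefinite_description, Hloc).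
destruct (compactness_value_2d (- r) r (- r) r (fun u v => proj1_sig (K u v)))
  as [d Hd].
exists (/ d); split; [left; apply Rinv_0_lt_compat, cond_pos|]; intros w Hw.
assert (Rabs (fst w) <= r /\ Rabs (snd w) <= r) as [H1 H2].
{ generalize (Rmax_Cmod w) (Rmax_l (Rabs (fst w)) (Rabs (snd w)))
    (Rmax_r (Rabs (fst w)) (Rabs (snd w))); lra. }
apply Rabs_le_between in H1; apply Rabs_le_between in H2.
(* [compactness_value_2d] gives its centre under a double negation, so the bound is proved by
   contradiction. *)
apply Rnot_lt_le; intros Hlt.
apply (Hd (fst w) (snd w)); [lra|lra|].
intros [u [v [_ [_ [U1 [U2 U3]]]]]]; destruct (K u v) as [d' Hd']; simpl in *.
specialize (Hd' w Hw U1 U2).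
apply Rinv_le_contravar in U3; [lra|apply cond_pos].
Qed.

Lemma korenblum0_iff (a : R) (f : C -> C) :
  korenblum0 a f <-> holo f /\ forall e, 0 < e -> exists r, 0 <= r < 1 /\
    forall z, r < Cmod z < 1 -> korenblum_weight a f z <= e.
Proof.
assert (W : forall z, 0 <= korenblum_weight a f z).
{ intros z; apply Rmult_le_pos; [left; apply Rpower_gt0|apply Cmod_ge_0]. }
split; intros [H1 H2]; split; try exact H1.
- intros e He.
  destruct (proj1 (filterlim_locally _ _) H2 (mkposreal e He)) as [d Hd].
  assert (P := cond_pos d).
  exists (Rmax 0 (1 - d)); split.
  + split; [apply Rmax_l|apply Rmax_lub_lt; lra].
  + intros z [Z1 Z2]; assert (Q := Rmax_r 0 (1 - d)).
    assert (B : Rabs (korenblum_weight a f z - 0) < e).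
    { apply (Hd (Cmod z)); [|exact Z2|reflexivity].
      apply Rabs_def1; unfold minus, plus, opp; simpl; lra. }
    rewrite Rminus_0_r, Rabs_pos_eq in B by apply W; lra.
- apply filterlim_locally; intros e.
  destruct (H2 (e / 2)) as [r [Hr Hw]].
  { generalize (cond_pos e); lra. }
  assert (P : 0 < 1 - r) by lra.
  exists (mkposreal _ P); intros x Hx Hx1 z Hz.
  assert (Hx' : Rabs (x - 1) < 1 - r) by exact Hx.
  apply Rabs_def2 in Hx'.
  specialize (Hw z ltac:(lra)).
  change (Rabs (korenblum_weight a f z - 0) < e).
  rewrite Rminus_0_r, Rabs_pos_eq by apply W.
  generalize (cond_pos e); lra.
Qed.

(** Only points near the circle count, so domination may begin at any radius below 1. From 1/2 on,
    dividing by z costs at most a factor 2. *)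
Lemma korenblum0_dominated (a K : R) (f h : C -> C) : holo f -> korenblum0 a h ->
  (forall z, / 2 < Cmod z < 1 -> Cmod (f z) <= K * Cmod (h z)) -> korenblum0 a f.
Proof.
intros Hf Hh HK; apply korenblum0_iff in Hh; destruct Hh as [_ Hh].
apply korenblum0_iff; split; [exact Hf|]; intros e He.
assert (PK := Rabs_pos K).
destruct (Hh (e / (Rabs K + 1))) as [r [Hr Hw]]; [apply Rdiv_lt_0_compat; lra|].
exists (Rmax (/ 2) r); split.
{ split; [apply Rle_trans with (2 := Rmax_r _ _); lra|apply Rmax_lub_lt; lra]. }
intros z [Z1 Z2]; assert (M1 := Rmax_l (/ 2) r); assert (M2 := Rmax_r (/ 2) r).
specialize (Hw z ltac:(lra)); specialize (HK z ltac:(lra)).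
unfold korenblum_weight in *.
assert (P := Rpower_gt0 (1 - Cmod z) a); assert (Q := Cmod_ge_0 (h z)).
apply Rle_trans with (Rpower (1 - Cmod z) a * ((Rabs K + 1) * Cmod (h z))).
- apply Rmult_le_compat_l; [lra|].
  apply Rle_trans with (1 := HK), Rmult_le_compat_r; [exact Q|].
  generalize (Rle_abs K); lra.
- apply (Rmult_le_compat_l (Rabs K + 1)) in Hw; [|lra].
  replace ((Rabs K + 1) * (e / (Rabs K + 1))) with e in Hw by (field; lra); lra.
Qed.

Lemma korenblum0_mult_Hinf (a : R) (f b : C -> C) :
  korenblum0 a f -> Hinf b -> korenblum0 a (fun z => f z * b z)%C.
Proof.
intros Hf [Hb [K HK]]; apply (korenblum0_dominated a K _ f); [|exact Hf|].
- apply holo_mult; [apply Hf|exact Hb].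
- intros z [_ Hz]; rewrite Cmod_mult, Rmult_comm.
  apply Rmult_le_compat_r; [apply Cmod_ge_0|now apply HK].
Qed.

(** The additional weight factor 1 - |z| tends to 0 at the circle. *)
Lemma korenblum_korenblum0_succ (a : R) (f : C -> C) :
  korenblum a f -> korenblum0 (a + 1) f.
Proof.
intros [Hf [M HM]]; apply korenblum0_iff; split; [exact Hf|]; intros e He.
assert (P := Rabs_pos M); set (k := e / (Rabs M + 1)).
assert (Hk : 0 < k) by (apply Rdiv_lt_0_compat; lra).
exists (Rmax 0 (1 - k)); split.
{ split; [apply Rmax_l|apply Rmax_lub_lt; lra]. }
intros z [Z1 Z2]; assert (M2 := Rmax_r 0 (1 - k)).
specialize (HM z Z2); unfold korenblum_weight in *.
rewrite Rpower_plus, Rpower_1 by lra.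
replace e with ((Rabs M + 1) * k) by (unfold k; field; lra).
apply Rle_trans with (M * (1 - Cmod z)).
- replace (Rpower (1 - Cmod z) a * (1 - Cmod z) * Cmod (f z))
    with (Rpower (1 - Cmod z) a * Cmod (f z) * (1 - Cmod z)) by ring.
  apply Rmult_le_compat_r; lra.
- apply Rle_trans with ((Rabs M + 1) * (1 - Cmod z)).
  + apply Rmult_le_compat_r; [lra|]; generalize (Rle_abs M); lra.
  + apply Rmult_le_compat_l; lra.
Qed.

Lemma linear_subspace_korenblum (a : R) : linear_subspace (korenblum a).
Proof.
split; [|split].
- split; [apply holo_const|]; exists 0; intros z _; unfold korenblum_weight.
  rewrite Cmod_0, Rmult_0_r; lra.
- intros f h [Hf [M HM]] [Hh [N HN]]; split; [now apply holo_plus|].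
  exists (M + N); intros z Hz; specialize (HM z Hz); specialize (HN z Hz).
  unfold korenblum_weight in *.
  assert (P := Rpower_gt0 (1 - Cmod z) a).
  apply Rle_trans with (Rpower (1 - Cmod z) a * (Cmod (f z) + Cmod (h z))).
  + apply Rmult_le_compat_l; [lra|apply Cmod_triangle].
  + lra.
- intros c f [Hf [M HM]]; split; [apply holo_mult; [apply holo_const|exact Hf]|].
  exists (Cmod c * M); intros z Hz; specialize (HM z Hz).
  unfold korenblum_weight in *; rewrite Cmod_mult.
  apply (Rmult_le_compat_l (Cmod c)) in HM; [lra|apply Cmod_ge_0].
Qed.

Lemma linear_subspace_korenblum0 (a : R) : linear_subspace (korenblum0 a).
Proof.
split; [|split].
- apply korenblum0_iff; split; [apply holo_const|].
  intros e He; exists 0; split; [lra|]; intros z _; unfold korenblum_weight.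
  rewrite Cmod_0, Rmult_0_r; lra.
- intros f h Hf Hh; apply korenblum0_iff in Hf; apply korenblum0_iff in Hh.
  destruct Hf as [Hf Lf], Hh as [Hh Lh].
  apply korenblum0_iff; split; [now apply holo_plus|]; intros e He.
  destruct (Lf (e / 2)) as [r [Hr HM]]; [lra|].
  destruct (Lh (e / 2)) as [s [Hs HN]]; [lra|].
  exists (Rmax r s); split.
  { split; [apply Rle_trans with (2 := Rmax_l _ _); lra|apply Rmax_lub_lt; lra]. }
  intros z [Z1 Z2]; assert (M1 := Rmax_l r s); assert (M2 := Rmax_r r s).
  specialize (HM z ltac:(lra)); specialize (HN z ltac:(lra)).
  unfold korenblum_weight in *.
  assert (P := Rpower_gt0 (1 - Cmod z) a).
  apply Rle_trans with (Rpower (1 - Cmod z) a * (Cmod (f z) + Cmod (h z))).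
  + apply Rmult_le_compat_l; [lra|apply Cmod_triangle].
  + lra.
- intros c f Hf; apply (korenblum0_dominated a (Cmod c) _ f); [|exact Hf|].
  + apply holo_mult; [apply holo_const|apply Hf].
  + intros z _; rewrite Cmod_mult; lra.
Qed.

(** * Growth of a function and of its primitive *)

Lemma holo_primitive (h : C -> C) : holo h -> holo (seg_int h 0).
Proof. intros Hh z Hz; exists (h z); now apply cderive_seg_int. Qed.

Lemma korenblum0_of_primitive (a : R) (h : C -> C) : 0 < a -> holo h ->
  korenblum0 a (seg_int h 0) -> korenblum0 (a + 1) h.
Proof.
intros Ha Hh HV; apply korenblum0_iff in HV; destruct HV as [HF HV].
set (F := seg_int h 0) in *.
apply korenblum0_iff; split; [exact Hh|]; intros e He.
(* The factor 2 comes from [cauchy_estimate], the power of 2 from 1 - |z| = 2 r in the weight. *)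
set (c := 2 * Rpower 2 (a + 1)).
assert (Hc : 0 < c) by (generalize (Rpower_gt0 2 (a + 1)); unfold c; lra).
destruct (HV (e / c)) as [r0 [Hr0 Hw]]; [now apply Rdiv_lt_0_compat|].
(* Beyond this radius |z| - (1 - |z|) / 2 > r0, so the whole disc around [z] lies where [Hw]
   applies. *)
exists ((2 * r0 + 1) / 3); split; [lra|]; intros z [Z1 Z2].
set (r := (1 - Cmod z) / 2); assert (Hr : 0 < r) by (unfold r; lra).
assert (near : forall w, Cmod (w - z) <= r -> r0 < Cmod w /\ r <= 1 - Cmod w).
{ intros w Hwz; generalize (Cmod_le_sub w z) (Cmod_le_sub z w).
  rewrite (Cmod_sub_sym z w); unfold r in *; lra. }
assert (B : Cmod (h z) <= 2 * (e / c * Rpower r (- a)) / r).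
{ apply (cauchy_estimate F z); [exact Hr| | |now apply cderive_seg_int].
  - intros w Hwz; apply HF; destruct (near w Hwz); unfold unit_disc; lra.
  - intros w Hwz; destruct (near w Hwz) as [N1 N2].
    specialize (Hw w ltac:(lra)); unfold korenblum_weight in Hw.
    assert (Mono : Rpower r a <= Rpower (1 - Cmod w) a)
      by (apply Rle_Rpower_l; lra).
    assert (Pr := Rpower_gt0 r a).
    apply Rmult_le_reg_l with (Rpower r a); [exact Pr|].
    replace (Rpower r a * (e / c * Rpower r (- a)))
      with (Rpower r a * Rpower r (- a) * (e / c)) by ring.
    rewrite Rpower_cancel, Rmult_1_l.
    apply Rle_trans with (2 := Hw), Rmult_le_compat_r; [apply Cmod_ge_0|exact Mono]. }
unfold korenblum_weight.
assert (E : Rpower (1 - Cmod z) (a + 1) = Rpower 2 (a + 1) * (Rpower r a * r)).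
{ replace (1 - Cmod z) with (2 * r) by (unfold r; field).
  rewrite <- Rpower_mult_distr by lra.
  now rewrite (Rpower_plus a 1 r), Rpower_1. }
rewrite E.
assert (P2 := Rpower_gt0 2 (a + 1)); assert (Pr := Rpower_gt0 r a).
apply Rle_trans with
  (Rpower 2 (a + 1) * (Rpower r a * r) * (2 * (e / c * Rpower r (- a)) / r)).
- apply Rmult_le_compat_l; [|exact B].
  left; apply Rmult_lt_0_compat; [|apply Rmult_lt_0_compat]; assumption.
- right; transitivity (c * (e / c) * (Rpower r a * Rpower r (- a))).
  + unfold c; field; split; lra.
  + rewrite Rpower_cancel; field; lra.
Qed.

(** The integrand bounds |h(t z) z| for x = |z|; the t-derivative of (e / a) (1 - t x)^-a is its
    second term. *)
Lemma is_RInt_korenblum_majorant (a e M x : R) : 0 < a -> 0 <= x < 1 ->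
  is_RInt (fun t => (M + e * Rpower (1 - t * x) (- (a + 1))) * x) 0 1
    (M * x + e / a * Rpower (1 - x) (- a) - e / a).
Proof.
intros Ha Hx.
set (Phi := fun t => M * x * t + e / a * Rpower (1 - t * x) (- a)).
replace (M * x + e / a * Rpower (1 - x) (- a) - e / a)
  with (minus (Phi 1) (Phi 0)).
2:{ unfold Phi, minus, plus, opp; simpl.
    rewrite Rmult_1_l, Rmult_0_l, Rminus_0_r.
    replace (Rpower 1 (- a)) with 1; [ring|].
    unfold Rpower; rewrite ln_1, Rmult_0_r, exp_0; reflexivity. }
assert (pos : forall t, Rmin 0 1 <= t <= Rmax 0 1 -> 0 < 1 - t * x).
{ rewrite Rmin_left, Rmax_right by lra; intros t [T1 T2].
  apply (Rmult_le_compat_r x) in T2; lra. }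
apply (is_RInt_derive Phi).
- intros t Ht; specialize (pos t Ht); unfold Phi, Rpower; auto_derive.
  + lra.
  + replace (- (a + 1) * ln (1 - t * x)) with
      (- a * ln (1 - t * x) + - ln (1 - t * x)) by ring.
    replace (1 + - (t * x)) with (1 - t * x) by ring.
    rewrite exp_plus, exp_Ropp, exp_ln by exact pos; field; lra.
- intros t Ht; specialize (pos t Ht); unfold Rpower.
  apply (ex_derive_continuous (V := R_NormedModule)); auto_derive; lra.
Qed.

Lemma primitive_korenblum0 (a : R) (h : C -> C) : 0 < a ->
  korenblum0 (a + 1) h -> korenblum0 a (seg_int h 0).
Proof.
intros Ha Hh; apply korenblum0_iff in Hh; destruct Hh as [Hh Hlim].
apply korenblum0_iff; split; [now apply holo_primitive|]; intros e He.
(* Radial integration divides by [a], leaving k / a = e / 2; the other half of [e] is reserved for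
   the bounded part [M]. *)
set (k := e * a / 2).
assert (Hk : 0 < k) by (unfold k; apply Rdiv_lt_0_compat; [apply Rmult_lt_0_compat|]; lra).
destruct (Hlim k Hk) as [r [Hr Hw]].
destruct (holo_bounded h r Hh ltac:(lra)) as [M [HM0 HM]].
assert (B : forall w, Cmod w < 1 ->
  Cmod (h w) <= M + k * Rpower (1 - Cmod w) (- (a + 1))).
{ intros w W1; assert (P := Rpower_gt0 (1 - Cmod w) (- (a + 1))).
  assert (P' := Rmult_lt_0_compat _ _ Hk P).
  destruct (Rle_lt_dec (Cmod w) r) as [L|L]; [specialize (HM w L); lra|].
  specialize (Hw w ltac:(lra)); unfold korenblum_weight in Hw.
  apply (Rmult_le_compat_r (Rpower (1 - Cmod w) (- (a + 1)))) in Hw; [|lra].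
  replace (Rpower (1 - Cmod w) (a + 1) * Cmod (h w) *
    Rpower (1 - Cmod w) (- (a + 1))) with (Rpower (1 - Cmod w) (a + 1) *
    Rpower (1 - Cmod w) (- (a + 1)) * Cmod (h w)) in Hw by ring.
  rewrite Rpower_cancel in Hw; lra. }
destruct (Rpower_small a (e / 2 / (M + 1))) as [d [Hd Hsmall]]; [exact Ha| |].
{ apply Rdiv_lt_0_compat; lra. }
exists (1 - d); split; [lra|]; intros z [Z1 Z2]; set (x := Cmod z) in *.
assert (Hx : 0 <= x) by apply Cmod_ge_0.
assert (SC : seg_cont h 0 z).
{ apply (diff_on_seg_cont (fun w => Cmod (w - 0) <= x)).
  - apply convex_cball.
  - now apply holo_diff_on.
  - now rewrite Csub_diag.
  - replace (z - 0)%C with z by ring; unfold x; lra. }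
assert (V : Cmod (seg_int h 0 z) <= M * x + k / a * Rpower (1 - x) (- a) - k / a).
{ rewrite Cmod_norm.
  apply (norm_RInt_le _ _ _ _ _ _ Rle_0_1) with (2 := seg_int_correct h 0 z SC)
    (3 := is_RInt_korenblum_majorant a k M x Ha (conj Hx Z2)).
  intros t Ht; rewrite <- Cmod_norm, Cmod_mult.
  replace (seg 0 z t) with (t * z)%C by (unfold seg; ring).
  replace (z - 0)%C with z by ring; fold x.
  apply Rmult_le_compat_r; [exact Hx|].
  assert (E : Cmod (t * z) = t * x)
    by (rewrite Cmod_mult, Cmod_R, Rabs_pos_eq; [reflexivity|lra]).
  rewrite <- E; apply B; rewrite E.
  apply Rle_lt_trans with (1 * x); [apply Rmult_le_compat_r; lra|lra]. }
assert (Hka : k / a = e / 2) by (unfold k; field; lra); rewrite Hka in V.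
specialize (Hsmall (1 - x) ltac:(lra)).
assert (P := Rpower_gt0 (1 - x) a).
unfold korenblum_weight; fold x.
apply Rle_trans with (Rpower (1 - x) a * (M + 1 + e / 2 * Rpower (1 - x) (- a))).
- apply Rmult_le_compat_l; [lra|].
  assert (M * x <= M * 1) by (apply Rmult_le_compat_l; lra); lra.
- replace (Rpower (1 - x) a * (M + 1 + e / 2 * Rpower (1 - x) (- a)))
    with ((M + 1) * Rpower (1 - x) a
      + e / 2 * (Rpower (1 - x) a * Rpower (1 - x) (- a))) by ring.
  rewrite Rpower_cancel.
  apply (Rmult_le_compat_l (M + 1)) in Hsmall; [|lra].
  replace ((M + 1) * (e / 2 / (M + 1))) with (e / 2) in Hsmall by (field; lra).
  lra.
Qed.

(** * The two integral operators *)

Lemma volterra_seg_int (g f : C -> C) (z : C) :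
  volterra g f z = seg_int (fun w => f w * C_derive g w)%C 0 z.
Proof.
apply (RInt_ext (V := C_R_CompleteNormedModule)); intros t _.
replace (seg 0 z t) with (t * z)%C by (unfold seg; ring).
now replace (z - 0)%C with z by ring.
Qed.

Lemma holo_local (f h : C -> C) : (forall z, f z = h z) -> holo f -> holo h.
Proof.
intros E Hf z Hz; destruct (Hf z Hz) as [l Hl]; exists l.
now apply (cderive_local f h z l 1 Rlt_0_1).
Qed.

(** Away from 0 this is a quotient of differentiable functions. At 0, with l = h'(0), the expansion
    F(w) = h(0) w + l w^2 / 2 + o(w^2) shows that the prescribed value h(0) is the right one and
    that the derivative is l / 2. *)
Lemma holo_volterra_avg (g f : C -> C) :
  holo (fun w => f w * C_derive g w)%C -> holo (volterra_avg g f).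
Proof.
set (h := fun w => (f w * C_derive g w)%C); intros Hh z Hz.
destruct (Ceq_dec z 0) as [->|Hz0].
- destruct (Hh (RtoC 0) Hz) as [l Hl]; exists (l / 2)%C.
  apply cderive_iff; intros e He.
  destruct (proj1 (cderive_iff h 0 l) Hl e He) as [d [Hd Hdl]].
  exists (Rmin d 1); split; [apply Rmin_glb_lt; lra|]; intros w Hw.
  assert (W1 := Rlt_le_trans _ _ _ Hw (Rmin_l _ _)).
  assert (W2 := Rlt_le_trans _ _ _ Hw (Rmin_r _ _)).
  assert (W0 : (w - 0)%C = w) by ring; rewrite W0 in *.
  unfold volterra_avg; destruct (Ceq_dec 0 0) as [_|N]; [|now elim N].
  destruct (Ceq_dec w 0) as [->|Hw0].
  + replace (f 0 * C_derive g 0 - f 0 * C_derive g 0 - l / 2 * 0)%C with (RtoC 0)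
      by field.
    rewrite Cmod_0; lra.
  + rewrite volterra_seg_int; fold h; change (f 0 * C_derive g 0)%C with (h 0).
    assert (A : Cmod (seg_int h 0 w - ((h 0 - l * 0) * (w - 0)
      + l * (w * w - 0 * 0) / 2)) <= e * Cmod w * Cmod (w - 0)).
    { apply seg_int_approx.
      - apply (diff_on_seg_cont (fun u => Cmod (u - 0) <= Cmod w)).
        + apply convex_cball.
        + now apply holo_diff_on.
        + rewrite Csub_diag; apply Cmod_ge_0.
        + rewrite W0; lra.
      - intros t Ht.
        replace (h (seg 0 w t) - (h 0 - l * 0 + l * seg 0 w t))%C
          with (h (seg 0 w t) - h 0 - l * (seg 0 w t - 0))%C by ring.
        assert (S : Cmod (seg 0 w t - 0) <= Cmod w).
        { apply seg_near; [exact Ht| |rewrite W0; lra].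
          rewrite Csub_diag; apply Cmod_ge_0. }
        apply Rle_trans with (1 := Hdl _ (Rle_lt_trans _ _ _ S W1)).
        apply Rmult_le_compat_l; lra. }
    assert (Pw := proj1 (Cmod_gt_0 w) Hw0); rewrite W0 in A.
    replace (/ w * seg_int h 0 w - h 0 - l / 2 * w)%C with
      ((seg_int h 0 w - ((h 0 - l * 0) * w + l * (w * w - 0 * 0) / 2)) / w)%C
      by (field; exact Hw0).
    rewrite Cmod_div by exact Hw0.
    apply Rmult_le_reg_r with (Cmod w); [exact Pw|].
    unfold Rdiv; rewrite Rmult_assoc, Rinv_l, Rmult_1_r by lra; exact A.
(* The radius |z| keeps [w] away from 0, so only the second branch of the definition is met. *)
- eexists; apply (cderive_local (fun w => / w * seg_int h 0 w)%C _ z _ (Cmod z)).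
  + now apply Cmod_gt_0.
  + intros w Hw; unfold volterra_avg; rewrite volterra_seg_int.
    destruct (Ceq_dec w 0) as [->|_]; [|reflexivity].
    replace (0 - z)%C with (- z)%C in Hw by ring; rewrite Cmod_opp in Hw; lra.
  + apply cderive_mult; [|now apply cderive_seg_int].
    apply (cderive_inv (fun w => w)); [apply cderive_id|exact Hz0].
Qed.

Lemma korenblum0_volterra_avg (a : R) (g f : C -> C) :
  holo (fun w => f w * C_derive g w)%C ->
  korenblum0 a (volterra g f) <-> korenblum0 a (volterra_avg g f).
Proof.
intros Hh; split; intros H.
- apply (korenblum0_dominated a 2 _ _ (holo_volterra_avg g f Hh) H).
  intros z [Z1 Z2]; unfold volterra_avg; destruct (Ceq_dec z 0) as [->|N].
  + rewrite Cmod_0 in Z1; lra.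
  + rewrite Cmod_mult, Cmod_inv by exact N.
    apply Rmult_le_compat_r; [apply Cmod_ge_0|].
    rewrite <- (Rinv_inv 2); apply Rinv_le_contravar; lra.
- apply (korenblum0_dominated a 1 _ (volterra_avg g f)); [|exact H|].
  + apply (holo_local (seg_int (fun w => f w * C_derive g w)%C 0)).
    * intros z; symmetry; apply volterra_seg_int.
    * now apply holo_primitive.
  + intros z [Z1 Z2]; unfold volterra_avg; destruct (Ceq_dec z 0) as [->|N].
    * rewrite Cmod_0 in Z1; lra.
    * replace (volterra g f z) with (z * (/ z * volterra g f z))%C at 1
        by (field; exact N).
      rewrite (Cmod_mult z); apply Rmult_le_compat_r; [apply Cmod_ge_0|lra].
Qed.

(** * A function separating the growth spaces *)

(* The principal square root; on the closed negative axis the division by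
   [D = 0] makes the value meaningless. *)
Definition csqrt (w : C) : C :=
  let D := sqrt (2 * (Cmod w + fst w)) in ((fst w + Cmod w) / D, snd w / D).

Lemma csqrt_spec (w : C) : 0 < fst w ->
  0 < fst (csqrt w) /\ (csqrt w * csqrt w)%C = w.
Proof.
intros Hw; assert (P := Cmod_ge_0 w).
assert (HD : 0 < sqrt (2 * (Cmod w + fst w))) by (apply sqrt_lt_R0; lra).
assert (E := sqrt_sqrt (2 * (Cmod w + fst w)) ltac:(lra)).
assert (N := Cmod2_alt w); unfold Re, Im in N.
unfold csqrt; set (D := sqrt (2 * (Cmod w + fst w))) in *.
destruct w as [x y]; simpl fst in *; simpl snd in *.
set (n := Cmod (x, y)) in *; split; [apply Rdiv_lt_0_compat; lra|].
unfold Cmult; simpl; f_equal; apply Rmult_eq_reg_r with (D * D); try lra.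
- transitivity ((x + n) * (x + n) - y * y); [field; lra|rewrite E].
  simpl in N; lra.
- transitivity (2 * y * (x + n)); [field; lra|rewrite E; ring].
Qed.

(** The slope is 1 / (csqrt v + csqrt w), because the squares differ by v - w. Both roots have
    positive real part, so the denominator is at least [s] in modulus; this gives continuity first,
    then the derivative. *)
Lemma cderive_csqrt (w : C) : 0 < fst w -> exists l, cderive csqrt w l.
Proof.
intros Hw; destruct (csqrt_spec w Hw) as [S0 Sq].
set (s := fst (csqrt w)) in *.
assert (near : forall v, Cmod (v - w) < fst w ->
  0 < fst v /\ s <= Cmod (csqrt v + csqrt w) /\
  csqrt v = (csqrt w + / (csqrt v + csqrt w) * (v - w))%C).
{ intros v Hv.
  assert (B : Rabs (fst (v - w)%C) <= Cmod (v - w))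
    by apply Rle_trans with (2 := Rmax_Cmod (v - w)%C), Rmax_l.
  simpl in B; assert (B' : Rabs (fst v + - fst w) < fst w) by lra.
  apply Rabs_def2 in B'; assert (Pv : 0 < fst v) by lra.
  destruct (csqrt_spec v Pv) as [Sv Sqv].
  assert (L : s <= Cmod (csqrt v + csqrt w)).
  { apply Rle_trans with (2 := re_le_Cmod _); rewrite re_plus.
    apply Rle_trans with (2 := Rle_abs _); unfold s, Re; lra. }
  repeat split; [exact Pv|exact L|].
  assert (N : (csqrt v + csqrt w)%C <> RtoC 0) by (apply Cmod_gt_0; lra).
  replace (v - w)%C with ((csqrt v + csqrt w) * (csqrt v - csqrt w))%C.
  - field; exact N.
  - transitivity (csqrt v * csqrt v - csqrt w * csqrt w)%C; [ring|].
    now rewrite Sqv, Sq. }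
assert (Hc : ccont csqrt w).
{ intros e He; exists (Rmin (fst w) (e * s)); split.
  { apply Rmin_glb_lt; [exact Hw|now apply Rmult_lt_0_compat]. }
  intros v Hv; destruct (near v) as [_ [L E]].
  { apply Rlt_le_trans with (1 := Hv), Rmin_l. }
  assert (N : (csqrt v + csqrt w)%C <> RtoC 0) by (apply Cmod_gt_0; lra).
  replace (csqrt v - csqrt w)%C with (/ (csqrt v + csqrt w) * (v - w))%C
    by (rewrite E at 2; ring).
  rewrite Cmod_mult, Cmod_inv by exact N.
  apply Rmult_lt_reg_l with (Cmod (csqrt v + csqrt w)); [lra|].
  rewrite <- Rmult_assoc, Rinv_r, Rmult_1_l by lra.
  apply Rlt_le_trans with (1 := Hv), Rle_trans with (1 := Rmin_r _ _).
  rewrite Rmult_comm; apply Rmult_le_compat_r; lra. }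
eexists; apply (cderive_slope csqrt (fun v => / (csqrt v + csqrt w))%C w (fst w)).
- exact Hw.
- apply ccont_inv.
  + apply ccont_plus; [exact Hc|apply ccont_const].
  + apply Cmod_gt_0; destruct (near w) as [_ [L _]]; [now rewrite Csub_diag|lra].
- intros v Hv; now apply near.
Qed.

Lemma holo_pow (f : C -> C) (n : nat) : holo f -> holo (fun z => (f z ^ n)%C).
Proof.
intros Hf; induction n as [|n IH]; simpl; [apply holo_const|now apply holo_mult].
Qed.

Lemma disc_right_half (z : C) : unit_disc z -> 0 < fst (1 - z)%C.
Proof.
unfold unit_disc; intros Hz; simpl; assert (B := re_le_Cmod z).
unfold Re in B; generalize (Rle_abs (fst z)); lra.
Qed.

Lemma holo_half_power (k : nat) : exists f : C -> C, holo f /\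
  forall z, unit_disc z -> Cmod (f z) = Rpower (Cmod (1 - z)) (- (INR k / 2)).
Proof.
exists (fun z => ((/ csqrt (1 + - z)) ^ k)%C); split.
- apply holo_pow; intros z Hz; assert (Hw := disc_right_half z Hz).
  destruct (csqrt_spec _ Hw) as [S0 _], (cderive_csqrt _ Hw) as [l Hl].
  eexists; apply cderive_inv.
  + apply (cderive_comp csqrt (fun v => 1 + - v)%C); [|exact Hl].
    apply cderive_plus; [apply cderive_const|].
    apply (cderive_local (fun v => (-1) * v)%C _ _ _ 1 Rlt_0_1).
    * intros v _; ring.
    * apply cderive_mult; [apply cderive_const|apply cderive_id].
  + intros E; unfold Cminus in S0; rewrite E in S0; simpl in S0; lra.
- intros z Hz; assert (Hw := disc_right_half z Hz).
  change (1 + - z)%C with (1 - z)%C; set (w := (1 - z)%C) in *.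
  destruct (csqrt_spec _ Hw) as [S0 Sq].
  assert (N : csqrt w <> RtoC 0)
    by (intros E; rewrite E in S0; simpl in S0; lra).
  assert (Ps := proj1 (Cmod_gt_0 _) N).
  rewrite Cmod_pow, Cmod_inv by exact N.
  (* |w| is the square of |csqrt w|, so the exponent - k / 2 counts twice and becomes - k. *)
  rewrite <- Sq at 2; rewrite Cmod_mult, <- Rpower_mult_distr by exact Ps.
  rewrite <- Rpower_plus.
  replace (- (INR k / 2) + - (INR k / 2)) with (- INR k) by field.
  rewrite Rpower_Ropp, Rpower_pow, pow_inv by exact Ps; reflexivity.
Qed.

Lemma korenblum0_not_korenblum (a : R) : 0 < a ->
  exists f, korenblum0 (a + 1) f /\ ~ korenblum a f.
Proof.
(* From n <= 2 a < n + 1, the exponent b = (n + 1) / 2 satisfies a < b <= a + 1/2. *)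
intros Ha; destruct (nfloor_ex (2 * a)) as [n Hn]; [lra|].
destruct (holo_half_power (S n)) as [f [Hf HN]].
set (b := INR (S n) / 2) in *.
assert (Hb : a < b < a + 1) by (unfold b; rewrite S_INR; lra).
clearbody b; exists f; split.
- apply korenblum0_iff; split; [exact Hf|]; intros e He.
  destruct (Rpower_small (a + 1 - b) e) as [d [Hd Hs]]; [lra|exact He|].
  exists (1 - d); split; [lra|]; intros z [Z1 Z2].
  unfold korenblum_weight; rewrite HN by exact Z2.
  (* As |1 - z| >= 1 - |z|, the weighted modulus is at most (1 - |z|)^(a + 1 - b). *)
  apply Rle_trans with (2 := Hs (1 - Cmod z) ltac:(lra)).
  replace (a + 1 - b) with ((a + 1) + - b) by ring; rewrite (Rpower_plus (a + 1)).
  apply Rmult_le_compat_l; [left; apply Rpower_gt0|].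
  rewrite !Rpower_Ropp; apply Rinv_le_contravar; [apply Rpower_gt0|].
  apply Rle_Rpower_l; [lra|]; split; [lra|].
  generalize (Cmod_le_sub 1 z); rewrite Cmod_1; lra.
- intros [_ [M HM]].
  assert (P := Rabs_pos M).
  destruct (Rpower_small (b - a) (/ (Rabs M + 1))) as [d [Hd Hs]]; [lra| |].
  { apply Rinv_0_lt_compat; lra. }
  (* On the positive radius, at z = 1 - x, the weighted modulus is exactly x^(a - b), which exceeds
     |M| for this [x]. *)
  set (x := d / 2); assert (Hx : 0 < x < d) by (unfold x; lra).
  specialize (Hs x Hx).
  assert (Ez : Cmod (RtoC (1 - x)) = 1 - x) by (rewrite Cmod_R; apply Rabs_pos_eq; lra).
  assert (Hz : unit_disc (RtoC (1 - x))) by (unfold unit_disc; lra).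
  specialize (HM _ Hz); unfold korenblum_weight in HM; rewrite (HN _ Hz), Ez in HM.
  rewrite <- RtoC_minus, Cmod_R in HM.
  replace (1 - (1 - x)) with x in HM by ring.
  rewrite (Rabs_pos_eq x), <- Rpower_plus in HM by lra.
  replace (a + - b) with (- (b - a)) in HM by ring.
  rewrite Rpower_Ropp in HM.
  apply Rinv_le_contravar in Hs; [|apply Rpower_gt0].
  rewrite Rinv_inv in Hs; generalize (Rle_abs M); lra.
Qed.

(** * The optimal domains *)

Lemma korenblum0_local (a : R) (f h : C -> C) : holo h -> korenblum0 a f ->
  (forall z, unit_disc z -> f z = h z) -> korenblum0 a h.
Proof.
intros Hh Hf E; apply (korenblum0_dominated a 1 h f Hh Hf).
intros z [_ Hz]; rewrite E by exact Hz; lra.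
Qed.

Lemma korenblum0_mult_unit (a : R) (f G : C -> C) : holo f -> Hinf G ->
  (forall z, unit_disc z -> G z <> RtoC 0) -> Hinf (fun z => / G z)%C ->
  korenblum0 a (fun z => f z * G z)%C <-> korenblum0 a f.
Proof.
intros Hf HG HG0 HGi; split; intros H.
- apply (korenblum0_local a (fun z => f z * G z * / G z)%C); [exact Hf| |].
  + now apply (korenblum0_mult_Hinf a (fun z => f z * G z)%C).
  + intros z Hz; field; auto.
- now apply korenblum0_mult_Hinf.
Qed.

Lemma korenblum0_primitive_iff (a : R) (h : C -> C) : 0 < a -> holo h ->
  korenblum0 a (seg_int h 0) <-> korenblum0 (a + 1) h.
Proof.
intros Ha Hh; split; [now apply korenblum0_of_primitive|].
now apply primitive_korenblum0.
Qed.

Lemma optimal_domain_volterra (a : R) (g f : C -> C) : 0 < a ->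
  Hinf (C_derive g) -> (forall z, unit_disc z -> C_derive g z <> RtoC 0) ->
  Hinf (fun z => / C_derive g z)%C ->
  optimal_domain (volterra g) (korenblum0 a) f <-> korenblum0 (a + 1) f.
Proof.
intros Ha HG HG0 HGi; set (h := fun w => (f w * C_derive g w)%C).
(* [volterra g f] and the primitive of [h] agree pointwise; membership is transported by
   [korenblum0_local] without function extensionality. *)
assert (E : holo f -> korenblum0 a (volterra g f) <-> korenblum0 a (seg_int h 0)).
{ intros Hf; assert (HV : holo (seg_int h 0)).
  { apply holo_primitive, holo_mult; [exact Hf|apply HG]. }
  split; intros H; refine (korenblum0_local a _ _ _ H _).
  - exact HV.
  - intros z _; apply volterra_seg_int.
  - refine (holo_local _ _ _ HV); intros z; symmetry; apply volterra_seg_int.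
  - intros z _; symmetry; apply volterra_seg_int. }
(* Holomorphy of g' is part of [Hinf (C_derive g)]. *)
assert (Hh : holo f -> holo h) by (intros Hf; apply holo_mult; [exact Hf|apply HG]).
split.
- intros [Hf H]; apply (korenblum0_mult_unit _ f _ Hf HG HG0 HGi).
  exact (proj1 (korenblum0_primitive_iff a h Ha (Hh Hf)) (proj1 (E Hf) H)).
- intros H; assert (Hf : holo f) by apply H; split; [exact Hf|].
  apply (E Hf), (proj2 (korenblum0_primitive_iff a h Ha (Hh Hf))).
  now apply (korenblum0_mult_unit _ f _ Hf HG HG0 HGi).
Qed.

Theorem corollary3p10 :
  forall (gamma : R) (g : C -> C),
    0 < gamma ->
    little_bloch g ->
    (exists z w : C, unit_disc z /\ unit_disc w /\ g z <> g w) ->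
    Hinf (C_derive g) ->
    (forall z : C, unit_disc z -> C_derive g z <> RtoC 0) ->
    Hinf (fun z : C => Cinv (C_derive g z)) ->
    proper_subspace (korenblum gamma)
      (optimal_domain (volterra g) (korenblum0 gamma)) /\
    (forall f : C -> C,
       optimal_domain (volterra g) (korenblum0 gamma) f <->
       optimal_domain (volterra_avg g) (korenblum0 gamma) f) /\
    (forall f : C -> C,
       optimal_domain (volterra_avg g) (korenblum0 gamma) f <->
       korenblum0 (gamma + 1) f).
Proof.
intros a g Ha _ _ HG HG0 HGi.
assert (V := fun f => optimal_domain_volterra a g f Ha HG HG0 HGi).
assert (T : forall f, optimal_domain (volterra g) (korenblum0 a) f <->
  optimal_domain (volterra_avg g) (korenblum0 a) f).
{ intros f; split; intros [Hf H]; split; try exact Hf;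
    apply (korenblum0_volterra_avg a g f); try exact H;
    (apply holo_mult; [exact Hf|apply HG]). }
split; [|split; [exact T|]].
(* Linearity of the optimal domain is transported from the growth space through [V], instead of
   being derived from additivity of the integral. *)
- destruct (linear_subspace_korenblum0 (a + 1)) as [Z [A S]].
  split; [apply linear_subspace_korenblum|split; [|split]].
  + split; [exact (proj2 (V _) Z)|split].
    * intros f h Hf Hh; exact (proj2 (V _) (A f h (proj1 (V f) Hf) (proj1 (V h) Hh))).
    * intros c f Hf; exact (proj2 (V _) (S c f (proj1 (V f) Hf))).
  + intros f Hf; exact (proj2 (V f) (korenblum_korenblum0_succ a f Hf)).
  + destruct (korenblum0_not_korenblum a Ha) as [f [H1 H2]].
    exists f; split; [exact (proj2 (V f) H1)|exact H2].
- intros f; exact (iff_trans (iff_sym (T f)) (V f)).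
Qed.
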